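(* Let $q=e^{\pi i\tau}$ with $\mathrm{Im}(\tau)>0$ (so $0<|q|<1$). Then $$\sum_{n=1}^{\infty}\left( \frac{q^{2n}}{(1-q^{2n})^2}-\frac{q^{6n}}{(1-q^{6n})^2}-\frac{2 q^{6n-3}}{(1-q^{6n-3})^2} \right) = \frac{\Pi_{q^3}^3}{\Pi_q}.$$
   Context: For complex $a$ and $|q|<1$, $(a;q)_\infty=\prod_{i=0}^{\infty}(1-aq^i)$. Ramanujan's theta function is $\psi(q)=\dfrac{(q^2;q^2)_\infty}{(q;q^2)_\infty}$. Gosper's $q$-constant is $\Pi_q = q^{1/4}\dfrac{(q^2;q^2)_\infty^2}{(q;q^2)_\infty^2}=q^{1/4}\psi^2(q)$. Powers of $q=e^{\pi i\tau}$ are understood as $q^{a}=e^{\pi i\tau a}$; thus for a positive integer $k$, $\Pi_{q^k}=q^{k/4}\psi^2(q^k)$ with $q^{k/4}=e^{\pi i\tau k/4}$. *)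

(* Defs.v *)
From Stdlib Require Import Reals Lra Lia Psatz.
From Coquelicot Require Import Coquelicot.

Local Open Scope C_scope.

Definition Cexp (z : C) : C :=
  RtoC (exp (Re z)) * (cos (Im z), sin (Im z)).

(* q^a for q = exp (PI i tau): the branch of a non-integral power is fixed by
   tau, not by the value of q. *)
Definition nome_pow (tau : C) (a : R) : C := Cexp (RtoC PI * Ci * tau * RtoC a).

Definition nome (tau : C) : C := nome_pow tau 1.

Fixpoint qpoch_fin (a q : C) (n : nat) : C :=
  match n with
  | O => 1
  | S m => qpoch_fin a q m * (1 - a * q ^ m)
  end.

(* The limit of the partial products. [lim] is total; that it is the actual
   limit whenever |q| < 1 is [qpoch_inf_correct]. *)
Definition qpoch_inf (a q : C) : C :=
  @lim C_CompleteNormedModule (filtermap (qpoch_fin a q) eventually).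

Definition psi (q : C) : C := qpoch_inf (q ^ 2) (q ^ 2) / qpoch_inf q (q ^ 2).

(* [Gosper_Pi tau k] is Gosper's constant at q^k, where q = [nome tau]. *)
Definition Gosper_Pi (tau : C) (k : nat) : C :=
  nome_pow tau (INR k / 4) * psi (nome tau ^ k) ^ 2.

Lemma qpoch_fin_bound (a q : C) (n : nat) : (Cmod q < 1)%R ->
  (Cmod (qpoch_fin a q n) <=
   exp (Cmod a * ((1 - Cmod q ^ n) / (1 - Cmod q))))%R.
Proof.
intros Hq; induction n as [|n IH]; cbn [qpoch_fin].
- rewrite Cmod_1; simpl.
  replace (Cmod a * ((1 - 1) / (1 - Cmod q)))%R with 0%R by (field; lra).
  rewrite exp_0; lra.
- rewrite Cmod_mult.
  replace (Cmod a * ((1 - Cmod q ^ S n) / (1 - Cmod q)))%R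
    with (Cmod a * ((1 - Cmod q ^ n) / (1 - Cmod q)) + Cmod a * Cmod q ^ n)%R
    by (simpl; field; lra).
  rewrite exp_plus.
  apply Rmult_le_compat; try apply Cmod_ge_0; [exact IH|].
  unfold Cminus; eapply Rle_trans; [apply Cmod_triangle|].
  rewrite Cmod_opp, Cmod_1, Cmod_mult, Cmod_pow.
  apply exp_ineq1_le.
Qed.

Lemma qpoch_inf_correct (a q : C) : (Cmod q < 1)%R ->
  filterlim (qpoch_fin a q) eventually (@locally C_UniformSpace (qpoch_inf a q)).
Proof.
intros Hq.
set (d := fun n => qpoch_fin a q (S n) - qpoch_fin a q n).
assert (Hq0 := Cmod_ge_0 q).
assert (Hd : @ex_series C_AbsRing C_NormedModule d).
{ apply (@ex_series_le C_AbsRing C_CompleteNormedModule d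
    (fun n => exp (Cmod a / (1 - Cmod q)) * Cmod a * Cmod q ^ n)%R).
  - intros n. change (Rle (Cmod (d n))
      (exp (Cmod a / (1 - Cmod q)) * Cmod a * Cmod q ^ n)%R).
    unfold d; cbn [qpoch_fin].
    replace (qpoch_fin a q n * (1 - a * q ^ n) - qpoch_fin a q n)
      with (- (qpoch_fin a q n * (a * q ^ n))) by ring.
    rewrite Cmod_opp, !Cmod_mult, Cmod_pow, Rmult_assoc.
    apply Rmult_le_compat_r.
    { apply Rmult_le_pos; [apply Cmod_ge_0|apply pow_le; lra]. }
    eapply Rle_trans; [apply qpoch_fin_bound, Hq|].
    assert (Hle : (Cmod a * ((1 - Cmod q ^ n) / (1 - Cmod q))
      <= Cmod a / (1 - Cmod q))%R).
    { unfold Rdiv; apply Rmult_le_compat_l; [apply Cmod_ge_0|].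
      assert (0 < / (1 - Cmod q))%R by (apply Rinv_0_lt_compat; lra).
      assert (0 <= Cmod q ^ n)%R by (apply pow_le; lra). nra. }
    destruct Hle as [Hlt|Heq];
      [left; apply exp_increasing, Hlt|rewrite Heq; apply Rle_refl].
  - apply (@ex_series_scal_l R_AbsRing).
    apply ex_series_geom. rewrite Rabs_pos_eq; lra. }
destruct Hd as [l Hl].
assert (Hsum : forall n, sum_n d n = qpoch_fin a q (S n) - 1).
{ induction n as [|n IH].
  - rewrite sum_O; unfold d; reflexivity.
  - rewrite sum_Sn, IH; unfold d.
    change (qpoch_fin a q (S n) - 1 + (qpoch_fin a q (S (S n)) - qpoch_fin a q (S n))
            = qpoch_fin a q (S (S n)) - 1); ring. }
assert (Hlim : filterlim (qpoch_fin a q) eventually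
                 (@locally C_UniformSpace (l + 1))).
{ intros P HP.
  assert (H1 : filterlim (fun n => Cplus (sum_n d n) 1) eventually
                 (@locally C_UniformSpace (l + 1))).
  { apply (filterlim_comp_2 (G := @locally C_UniformSpace l)
             (H := @locally C_UniformSpace (RtoC 1))).
    - intros Q HQ. apply Hl. exact HQ.
    - apply filterlim_const.
    - apply (@filterlim_plus C_AbsRing C_NormedModule l (RtoC 1)). }
  destruct (H1 P HP) as [N HN].
  exists (S N); intros [|n] Hn; [lia|].
  specialize (HN n ltac:(lia)). rewrite Hsum in HN.
  replace (qpoch_fin a q (S n)) with (qpoch_fin a q (S n) - 1 + 1) by ring.
  exact HN. }
intros P [eps HP].
unfold qpoch_inf.
assert (HF : ProperFilter (filtermap (qpoch_fin a q) eventually))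
  by (apply filtermap_proper_filter, eventually_filter).
assert (Hc : cauchy (T := C_UniformSpace) (filtermap (qpoch_fin a q) eventually)).
{ apply (cauchy_distance (T := C_UniformSpace)).
  intros e. exists (ball (l + 1 : C_UniformSpace) (pos_div_2 e)). split.
  - apply Hlim, locally_ball.
  - intros u v Hu Hv.
    replace (pos e) with (pos_div_2 e + pos_div_2 e)%R by (simpl; lra).
    apply ball_triangle with (l + 1 : C_UniformSpace); [apply ball_sym|]; assumption. }
generalize (@complete_cauchy C_CompleteNormedModule _ HF Hc eps).
apply filter_imp. exact HP.
Qed.

(* Main.v *)
Require Import Defs.
From Stdlib Require Import Reals Lia Lra.
From Coquelicot Require Import Coquelicot.

Open Scope C_scope.

(** Put [p = q^6] and [koebe x = x / (1 - x)^2].  Sorting the terms by residues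
    modulo 3, the left-hand side becomes the sum over all integers [j] of
    [koebe (b p^j) - koebe (a p^j)] with [b = q^2] and [a = q^3].  As a function
    of [x], the sum of the [koebe (x p^j)] is the Weierstrass function of the torus
    [C^* / p^Z] up to constants, so the identity is an instance of the classical
    factorization of a difference of two values of that function.

    The factorization is obtained here from Kronecker's sum
    [F a b = sum_j a^j / (1 - b p^j)], in two steps.

    1. [F a b] is a quotient of theta functions ([kronecker_sum]).  A finite
       version of this is a partial fraction decomposition in [b]
       ([kronecker_partial_fractions]), and a passage to the limit under the
       sum gives the infinite one.

    2. With [a a' = p], the product [b (F a b) (F a' b)] is the difference
       [sum_j koebe (b p^j) - sum_j koebe (a p^j)] ([kronecker_product]).
       Multiplying the two sums out, the diagonal terms give the values of [koebe] at
       [b p^j].  An off-diagonal term splits, again by partial fractions, into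
       [1/(1 - b p^j) - 1/(1 - b p^i)] times a weight that depends on [i - j]
       only; the sum over the pairs with a given difference telescopes
       ([off_diagonal_sum]), which leaves a Lambert series in [a] and [a'], and
       this series is the sum of the [koebe (a p^j)] ([lambert_sum]).

    For [p = q^6] the choice [a = a' = q^3] makes the two factors in the second
    step equal, and for [b = q^2] the theta quotient in the first step is
    [psi (q^3)^3 / psi q] ([psi_cubed_quotient]).  So the sum is
    [q^2 (psi (q^3)^3 / psi q)^2], which is the quotient of Gosper's constants,
    because [3 * 3/4 = 1/4 + 2].

    Bilateral sums are handled as limits of sums over the windows
    [-N <= j <= N], re-indexed by [i = N + j < 2 N + 1]; a parameter [b] and its
    partner [b' = p/b] play symmetric roles for the non-negative and the
    negative indices. *)

(** * Finite sums *)

Fixpoint csum (f : nat -> C) (n : nat) : C :=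
  match n with
  | O => 0
  | S m => csum f m + f m
  end.

Lemma csum_ext (f g : nat -> C) n :
  (forall k, (k < n)%nat -> f k = g k) -> csum f n = csum g n.
Proof.
induction n as [|n IH]; intros H; simpl; [reflexivity|].
rewrite IH, H by (intros; try apply H; lia); reflexivity.
Qed.

Lemma csum_plus (f g : nat -> C) n :
  csum (fun k => f k + g k) n = csum f n + csum g n.
Proof. induction n as [|n IH]; simpl; [|rewrite IH]; ring. Qed.

Lemma csum_minus (f g : nat -> C) n :
  csum (fun k => f k - g k) n = csum f n - csum g n.
Proof. induction n as [|n IH]; simpl; [|rewrite IH]; ring. Qed.

Lemma csum_scal (c : C) (f : nat -> C) n :
  csum (fun k => c * f k) n = c * csum f n.
Proof. induction n as [|n IH]; simpl; [|rewrite IH]; ring. Qed.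

Lemma csum_scal_r (c : C) (f : nat -> C) n :
  csum (fun k => f k * c) n = csum f n * c.
Proof. induction n as [|n IH]; simpl; [|rewrite IH]; ring. Qed.

Lemma csum_add_r (f : nat -> C) n m :
  csum f (n + m) = csum f n + csum (fun k => f (n + k)%nat) m.
Proof.
induction m as [|m IH]; simpl.
- rewrite Nat.add_0_r; ring.
- rewrite Nat.add_succ_r; simpl; rewrite IH; ring.
Qed.

Lemma csum_first (f : nat -> C) n :
  csum f (S n) = f O + csum (fun k => f (S k)) n.
Proof.
change (S n) with (1 + n)%nat; rewrite csum_add_r; simpl; ring.
Qed.

Lemma csum_rev (f : nat -> C) n :
  csum f n = csum (fun k => f (n - 1 - k)%nat) n.
Proof.
induction n as [|n IH]; [reflexivity|].
rewrite (csum_first (fun k => f (S n - 1 - k)%nat)).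
change (csum f (S n)) with (csum f n + f n); rewrite IH, Cplus_comm.
f_equal; [f_equal; lia|apply csum_ext; intros; f_equal; lia].
Qed.

Lemma csum_swap (f : nat -> nat -> C) n m :
  csum (fun i => csum (f i) m) n = csum (fun j => csum (fun i => f i j) n) m.
Proof.
induction n as [|n IH]; simpl.
- induction m as [|m IHm]; simpl; [|rewrite <- IHm]; ring.
- rewrite IH, csum_plus; reflexivity.
Qed.

Lemma csum_central (f : nat -> C) N :
  csum f (2 * N + 1) =
  csum (fun n => f (N + n)%nat) (N + 1) + csum (fun n => f (N - 1 - n)%nat) N.
Proof.
replace (2 * N + 1)%nat with (N + (N + 1))%nat by lia.
rewrite csum_add_r, (csum_rev f N); ring.
Qed.

(** * Algebra of finite q-shifted factorials *)

Lemma qpoch_fin_first (a q : C) n :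
  qpoch_fin a q (S n) = (1 - a) * qpoch_fin (a * q) q n.
Proof.
induction n as [|n IH]; [simpl; ring|].
change (qpoch_fin a q (S (S n)))
  with (qpoch_fin a q (S n) * (1 - a * q ^ S n)).
rewrite IH; simpl; ring.
Qed.

Lemma qpoch_fin_add (a q : C) n m :
  qpoch_fin a q (n + m) = qpoch_fin a q n * qpoch_fin (a * q ^ n) q m.
Proof.
induction m as [|m IH]; [rewrite Nat.add_0_r; simpl; ring|].
rewrite Nat.add_succ_r; cbn [qpoch_fin]; rewrite IH, Cpow_add_r; ring.
Qed.

Lemma qpoch_fin_neq_0 (a q : C) n :
  (forall k, (k < n)%nat -> 1 - a * q ^ k <> 0) -> qpoch_fin a q n <> 0.
Proof.
induction n as [|n IH]; intros H; cbn [qpoch_fin]; [exact C1_nz|].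
apply Cmult_neq_0; [apply IH; intros; apply H|apply H]; lia.
Qed.

(** Reversing the order of the factors turns [(x/p^n; p)_n] into
    [(-x)^n p^(-n(n+1)/2) (p/x; p)_n]; stated as a proportion between two
    values of [x], the sign and the power of [p] cancel. *)
Lemma qpoch_fin_reverse (p x z : C) n : p <> 0 -> x <> 0 -> z <> 0 ->
  qpoch_fin (x / p ^ n) p n * z ^ n * qpoch_fin (p / z) p n =
  qpoch_fin (z / p ^ n) p n * x ^ n * qpoch_fin (p / x) p n.
Proof.
intros Hp Hx Hz; induction n as [|n IH]; [reflexivity|].
rewrite !qpoch_fin_first.
assert (Hn : p ^ n <> 0) by (apply Cpow_nz; exact Hp).
rewrite !Cpow_S.
replace (x / (p * p ^ n) * p) with (x / p ^ n) by (field; auto).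
replace (z / (p * p ^ n) * p) with (z / p ^ n) by (field; auto).
rewrite <- (qpoch_fin_first (p / z)), <- (qpoch_fin_first (p / x)).
cbn [qpoch_fin].
transitivity (qpoch_fin (x / p ^ n) p n * z ^ n * qpoch_fin (p / z) p n *
  ((1 - x / (p * p ^ n)) * (z - p * p ^ n))); [field; auto|].
rewrite IH; field; auto.
Qed.

(** The coefficient of [1 / (1 - c p^k)] in the partial fraction decomposition
    of [(a c; p)_M / (c; p)_(M+1)] in [c], where [a' = p/a]. *)
Definition kronecker_coef (a a' p : C) (M k : nat) : C :=
  a ^ k * qpoch_fin a' p k * qpoch_fin a p (M - k) /
  (qpoch_fin p p k * qpoch_fin p p (M - k)).

Lemma kronecker_coef_S (a a' p : C) M k : (k <= M)%nat ->
  (forall n, 1 - p ^ S n <> 0) ->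
  kronecker_coef a a' p (S M) k =
  kronecker_coef a a' p M k *
    ((1 - a * p ^ (M - k)) / (1 - p ^ S (M - k))).
Proof.
intros Hk Hp; unfold kronecker_coef.
replace (S M - k)%nat with (S (M - k)) by lia; cbn [qpoch_fin].
assert (forall n, qpoch_fin p p n <> 0)
  by (intros; apply qpoch_fin_neq_0; intros; apply (Hp k0)).
specialize (Hp (M - k)%nat); cbn [Cpow] in *. field; auto.
Qed.

(** Multiplying the decomposition for [M] by
    [(1 - a c p^M) / (1 - c p^(M+1))] changes the old coefficients as wanted; the
    new one is [1 - a/p] times the value of the old decomposition at the new
    pole [c = p^(-M-1)], which is why the induction hypothesis has to hold for
    all [c]. *)
Lemma kronecker_partial_fractions (a a' p : C) M :
  p <> 0 -> a * a' = p -> (forall n, 1 - p ^ S n <> 0) ->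
  forall c, (forall k, (k <= M)%nat -> 1 - c * p ^ k <> 0) ->
  csum (fun k => kronecker_coef a a' p M k / (1 - c * p ^ k)) (S M) =
  qpoch_fin (a * c) p M / qpoch_fin c p (S M).
Proof.
intros Hp Haa Hpn.
assert (Ha : a <> 0) by (intros ->; apply Hp; rewrite <- Haa; ring).
assert (Hpp : forall n, qpoch_fin p p n <> 0)
  by (intros; apply qpoch_fin_neq_0; intros; apply (Hpn k)).
assert (Hpw : forall n, p ^ n <> 0) by (intros; apply Cpow_nz; exact Hp).
assert (Ea' : a' = p / a) by (rewrite <- Haa; field; exact Ha).
induction M as [|M IH]; intros c Hc.
- assert (H0 := Hc 0%nat (le_n 0)); simpl in *; unfold kronecker_coef; simpl.
  field. intros E; apply H0; rewrite <- E; ring.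
- set (P := p ^ S M).
  assert (HP : P <> 0) by apply Hpw.
  assert (HcP : 1 - c * P <> 0) by (apply Hc; lia).
  (* the new pole is not among the old ones *)
  assert (Hpole : forall k, (k <= M)%nat -> 1 - / P * p ^ k <> 0).
  { intros k Hk E. apply (Hpn (M - k)%nat).
    replace (1 - p ^ S (M - k)) with (- p ^ S (M - k) * (1 - / P * p ^ k)).
    - rewrite E; ring.
    - unfold P; replace (S M) with (S (M - k) + k)%nat by lia.
      rewrite Cpow_add_r; field; split; apply Hpw. }
  assert (HR : kronecker_coef a a' p (S M) (S M) = (1 - a / p) *
     csum (fun k => kronecker_coef a a' p M k / (1 - / P * p ^ k)) (S M)).
  { rewrite (IH (/ P) Hpole). unfold kronecker_coef.
    rewrite Nat.sub_diag; simpl (qpoch_fin a p 0); simpl (qpoch_fin p p 0).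
    assert (R := qpoch_fin_reverse p a 1 (S M) Hp Ha C1_nz).
    rewrite Cpow_1_l in R. fold P in R.
    replace (p / 1) with p in R by field.
    replace (1 / P) with (/ P) in R by (field; exact HP).
    rewrite <- Ea' in R.
    assert (HqP : qpoch_fin (/ P) p (S M) <> 0)
      by (apply qpoch_fin_neq_0; intros; apply Hpole; lia).
    replace (qpoch_fin (a / P) p (S M))
      with (qpoch_fin (a * / P) p M * (1 - a / p)) in R.
    2:{ cbn [qpoch_fin]. replace (a / P * p ^ M) with (a / p); [reflexivity|].
        unfold P; rewrite Cpow_S; field; auto. }
    transitivity (qpoch_fin (/ P) p (S M) * a ^ S M * qpoch_fin a' p (S M) /
                  (qpoch_fin (/ P) p (S M) * qpoch_fin p p (S M))).
    - field; auto.
    - rewrite <- R; field; split; auto. }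
  change (csum (fun k => kronecker_coef a a' p (S M) k / (1 - c * p ^ k)) (S M)
    + kronecker_coef a a' p (S M) (S M) / (1 - c * P) =
    qpoch_fin (a * c) p (S M) / qpoch_fin c p (S (S M))).
  rewrite HR.
  transitivity
   (csum (fun k => kronecker_coef a a' p M k / (1 - c * p ^ k)) (S M) *
    ((1 - a * c * p ^ M) / (1 - c * P))).
  + match goal with |- _ + ?u * ?S / ?v = _ =>
      replace (u * S / v) with (S * (u / v)) by (field; auto) end.
    rewrite <- !csum_scal_r, <- csum_plus; apply csum_ext; intros k Hk.
    rewrite kronecker_coef_S by (auto; lia).
    assert (Hck : 1 - c * p ^ k <> 0) by (apply Hc; lia).
    assert (Hk' := Hpole k ltac:(lia)). assert (Hm := Hpn (M - k)%nat).
    revert HP HcP Hk'; unfold P.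
    replace (p ^ S M) with (p * p ^ (M - k) * p ^ k)
      by (rewrite <- Cmult_assoc, <- Cpow_add_r, Nat.sub_add by lia; reflexivity).
    replace (p ^ M) with (p ^ (M - k) * p ^ k)
      by (rewrite <- Cpow_add_r, Nat.sub_add by lia; reflexivity).
    rewrite Cpow_S in *.
    assert (Hd := Hpw k). assert (He := Hpw (M - k)%nat).
    set (u := p ^ k) in *. set (v := p ^ (M - k)) in *.
    intros HP HcP Hk'.
    assert (Hpv : p * v - 1 <> 0).
    { intros E; apply Hm; replace (1 - p * v) with (- (p * v - 1)) by ring.
      rewrite E; ring. }
    field; repeat split; auto.
  + rewrite IH by (intros; apply Hc; lia).
    assert (qpoch_fin c p (S M) <> 0)
      by (apply qpoch_fin_neq_0; intros; apply Hc; lia).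
    change (qpoch_fin c p (S (S M))) with (qpoch_fin c p (S M) * (1 - c * P)).
    change (qpoch_fin (a * c) p (S M))
      with (qpoch_fin (a * c) p M * (1 - a * c * p ^ M)).
    field; split; auto.
Qed.
(** * Product of two truncated bilateral sums *)

(** The sum [x + 2 x^2 + 3 x^3 + ...]; the series to be summed is built
    from its values at powers of [q]. *)
Definition koebe (x : C) : C := x / (1 - x) ^ 2.

Lemma koebe_inv (x : C) : x <> 0 -> 1 - x <> 0 -> koebe (/ x) = koebe x.
Proof.
intros Hx H1; unfold koebe.
assert (x - 1 <> 0)
  by (intros E; apply H1; replace (1 - x) with (- (x - 1)) by ring;
      rewrite E; ring).
field; auto.
Qed.

(** The common weight of the pairs of indices that differ by [k] in either
    direction: exchanging the two indices exchanges [a] and [a']. *)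
Definition lambert_weight (a a' p : C) (k : nat) : C :=
  (a ^ k + a' ^ k) / (1 - p ^ k).

(** Off the diagonal, the product of the two geometric-type denominators is
    resolved by
    [c p^j / ((1 - c p^i) (1 - c p^j)) = (g j - g i) / (1 - p^(i-j))],
    with [g i = 1 / (1 - c p^i)]; the pairs with a given difference
    [|i - j| = k + 1] then share a common weight. *)
Lemma truncated_product (a a' p c : C) M :
  a * a' = p -> (forall n, 1 - p ^ S n <> 0) ->
  (forall k, (k < M)%nat -> 1 - c * p ^ k <> 0) ->
  let g i := / (1 - c * p ^ i) in
  c * csum (fun i => a ^ i * g i) M * csum (fun j => a' ^ j * g j) M =
  csum (fun i => koebe (c * p ^ i)) M +
  csum (fun k => lambert_weight a a' p (S k) *
                 csum (fun i => g i - g (i + S k)%nat) (M - S k)) M.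
Proof.
intros Haa Hpn Hc g; induction M as [|M IH]; [simpl; ring|].
assert (HM : 1 - c * p ^ M <> 0) by (apply Hc; lia).
specialize (IH ltac:(intros; apply Hc; lia)).
set (A := csum (fun i => a ^ i * g i) M) in *.
set (A' := csum (fun j => a' ^ j * g j) M) in *.
assert (Hoff : c * g M * (a ^ M * A' + a' ^ M * A) =
  csum (fun k => lambert_weight a a' p (S k) * (g (M - S k)%nat - g M)) M).
{ rewrite csum_rev; unfold A, A'.
  rewrite <- !csum_scal, <- csum_plus, <- csum_scal.
  apply csum_ext; intros j Hj; unfold lambert_weight.
  replace (M - S (M - 1 - j))%nat with j by lia.
  replace (S (M - 1 - j)) with (M - j)%nat by lia.
  assert (Hj' := Hc j ltac:(lia)).
  assert (Hd := Hpn (M - 1 - j)%nat).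
  replace (S (M - 1 - j)) with (M - j)%nat in Hd by lia.
  assert (EM : forall x : C, x ^ M = x ^ (M - j) * x ^ j)
    by (intros; rewrite <- Cpow_add_r; f_equal; lia).
  revert HM; unfold g; rewrite !EM, <- Haa, !Cpow_mult_l.
  rewrite <- Haa, !Cpow_mult_l in Hd, Hj'.
  intros HM; field; repeat split; auto. }
assert (Hnew : csum (fun k => lambert_weight a a' p (S k) *
    csum (fun i => g i - g (i + S k)%nat) (S M - S k)) (S M) =
  csum (fun k => lambert_weight a a' p (S k) *
    csum (fun i => g i - g (i + S k)%nat) (M - S k)) M +
  c * g M * (a ^ M * A' + a' ^ M * A)).
{ rewrite Hoff, <- csum_plus.
  change (csum ?f (S M)) with (csum f M + f M); cbv beta.
  rewrite Nat.sub_diag; change (csum ?f 0) with (0 : C).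
  rewrite Cmult_0_r, Cplus_0_r.
  apply csum_ext; intros k Hk.
  replace (S M - S k)%nat with (S (M - S k)) by lia.
  change (csum ?f (S (M - S k))) with (csum f (M - S k) + f (M - S k)%nat).
  cbv beta; replace (M - S k + S k)%nat with M by lia. ring. }
rewrite Hnew.
change (csum ?f (S M)) with (csum f M + f M); cbv beta.
fold A A'.
transitivity (c * A * A' + c * g M * (a ^ M * A' + a' ^ M * A) +
   c * (a ^ M * a' ^ M) * g M * g M); [ring|].
rewrite IH, <- Cpow_mult_l, Haa; unfold koebe, g; field; exact HM.
Qed.

(** The indices [i] and the indices [i + k] cover the same values except for
    [k] of them at either end of the window. *)
Lemma csum_telescope (g : nat -> C) M k : (k <= M)%nat ->
  csum (fun i => g i - g (i + k)%nat) (M - k) =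
  csum (fun i => g i - g (M - 1 - i)%nat) k.
Proof.
intros Hk; rewrite !csum_minus.
assert (H1 := csum_add_r g (M - k) k).
assert (H2 := csum_add_r g k (M - k)).
rewrite Nat.sub_add in H1 by lia.
replace (k + (M - k))%nat with M in H2 by lia.
rewrite (csum_rev (fun i => g (M - 1 - i)%nat)).
rewrite (csum_ext (fun i => g (M - 1 - (k - 1 - i))%nat)
  (fun i => g (M - k + i)%nat)) by (intros; f_equal; lia).
rewrite (csum_ext (fun i => g (i + k)%nat) (fun i => g (k + i)%nat))
  by (intros; f_equal; lia).
rewrite H2 in H1.
match goal with |- ?u - ?v = ?x - ?y =>
  transitivity ((u + y) - y - v); [ring|rewrite <- H1; ring] end.
Qed.
(** * Convergence of complex sequences *)

Definition cvg (u : nat -> C) (l : C) : Prop :=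
  is_lim_seq (fun n => Cmod (u n - l)) 0.

Lemma cvg_of_bound (u : nat -> C) (l : C) (e : nat -> R) :
  (forall n, (Cmod (u n - l) <= e n)%R) -> is_lim_seq e 0 -> cvg u l.
Proof.
intros H He.
apply (is_lim_seq_le_le (fun _ => 0%R) _ e); [|apply is_lim_seq_const|exact He].
intros n; split; [apply Cmod_ge_0|apply H].
Qed.

Lemma is_lim_seq_eq (u : nat -> R) (l l' : R) :
  is_lim_seq u l -> l = l' -> is_lim_seq u l'.
Proof. intros H <-; exact H. Qed.

Lemma cvg_ext (u v : nat -> C) (l : C) : (forall n, u n = v n) -> cvg u l -> cvg v l.
Proof. intros H; apply is_lim_seq_ext; intros; rewrite H; reflexivity. Qed.

Lemma cvg_eq (u : nat -> C) (l l' : C) : cvg u l -> l = l' -> cvg u l'.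
Proof. intros H <-; exact H. Qed.

Lemma cvg_const (c : C) : cvg (fun _ => c) c.
Proof.
apply (is_lim_seq_ext (fun _ => 0%R)); [|apply is_lim_seq_const].
intros; replace (c - c) with (0 : C) by ring; rewrite Cmod_0; reflexivity.
Qed.

Lemma cvg_plus (u v : nat -> C) (l m : C) :
  cvg u l -> cvg v m -> cvg (fun n => u n + v n) (l + m).
Proof.
intros Hu Hv.
apply cvg_of_bound with (fun n => (Cmod (u n - l) + Cmod (v n - m))%R).
- intros n; replace (u n + v n - (l + m)) with ((u n - l) + (v n - m)) by ring.
  apply Cmod_triangle.
- apply is_lim_seq_eq with (0 + 0)%R; [|ring].
  apply is_lim_seq_plus'; assumption.
Qed.

Lemma cvg_mod (u : nat -> C) (l : C) :
  cvg u l -> is_lim_seq (fun n => Cmod (u n)) (Cmod l).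
Proof.
intros Hu.
apply (is_lim_seq_le_le (fun n => Cmod l - Cmod (u n - l))%R _
  (fun n => Cmod l + Cmod (u n - l))%R).
- intros n; split.
  + assert (H := Cmod_triangle (u n) (- (u n - l))).
    replace (u n + - (u n - l)) with l in H by ring.
    rewrite Cmod_opp in H; lra.
  + assert (H := Cmod_triangle l (u n - l)).
    replace (l + (u n - l)) with (u n) in H by ring. lra.
- apply is_lim_seq_eq with (Cmod l - 0)%R; [|ring].
  apply is_lim_seq_minus'; [apply is_lim_seq_const|exact Hu].
- apply is_lim_seq_eq with (Cmod l + 0)%R; [|ring].
  apply is_lim_seq_plus'; [apply is_lim_seq_const|exact Hu].
Qed.

Lemma cvg_mult (u v : nat -> C) (l m : C) :
  cvg u l -> cvg v m -> cvg (fun n => u n * v n) (l * m).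
Proof.
intros Hu Hv.
apply cvg_of_bound with
  (fun n => (Cmod (u n - l) * Cmod (v n) + Cmod l * Cmod (v n - m))%R).
- intros n; rewrite <- !Cmod_mult.
  replace (u n * v n - l * m) with ((u n - l) * v n + l * (v n - m)) by ring.
  apply Cmod_triangle.
- apply is_lim_seq_eq with (0 * Cmod m + Cmod l * 0)%R; [|ring].
  apply is_lim_seq_plus'; apply is_lim_seq_mult'; try assumption.
  + apply cvg_mod; exact Hv.
  + apply is_lim_seq_const.
Qed.

Lemma cvg_scal (c : C) (u : nat -> C) (l : C) :
  cvg u l -> cvg (fun n => c * u n) (c * l).
Proof. apply cvg_mult, cvg_const. Qed.

Lemma cvg_minus (u v : nat -> C) (l m : C) :
  cvg u l -> cvg v m -> cvg (fun n => u n - v n) (l - m).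
Proof.
intros Hu Hv; apply (cvg_ext (fun n => u n + - (1) * v n)); [intros; ring|].
apply cvg_eq with (l + - (1) * m); [|ring].
apply cvg_plus; [|apply cvg_scal]; assumption.
Qed.

Lemma cvg_inv (u : nat -> C) (l : C) :
  (forall n, u n <> 0) -> l <> 0 -> cvg u l -> cvg (fun n => / u n) (/ l).
Proof.
intros Hn Hl Hu.
assert (Hl' : (0 < Cmod l)%R) by (apply Cmod_gt_0; exact Hl).
apply (is_lim_seq_ext (fun n => Cmod (u n - l) * / (Cmod (u n) * Cmod l))%R).
- intros n; rewrite <- Cmod_mult, <- Cmod_inv, <- Cmod_mult
    by (apply Cmult_neq_0; auto).
  rewrite <- (Cmod_opp (/ u n - / l)); f_equal; field; auto.
- apply is_lim_seq_eq with (0 * / (Cmod l * Cmod l))%R; [|ring].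
  apply is_lim_seq_mult'; [exact Hu|].
  apply (is_lim_seq_inv _ (Cmod l * Cmod l)%R).
  + apply is_lim_seq_mult'; [apply cvg_mod; exact Hu|apply is_lim_seq_const].
  + intros E; injection E; intros; nra.
Qed.

Lemma cvg_div (u v : nat -> C) (l m : C) : (forall n, v n <> 0) -> m <> 0 ->
  cvg u l -> cvg v m -> cvg (fun n => u n / v n) (l / m).
Proof. intros; apply cvg_mult; [|apply cvg_inv]; assumption. Qed.

Lemma cvg_unique (u : nat -> C) (l m : C) : cvg u l -> cvg u m -> l = m.
Proof.
intros Hl Hm.
assert (H := cvg_minus _ _ _ _ Hl Hm); apply cvg_mod in H.
apply (is_lim_seq_ext _ (fun _ => 0%R)) in H.
2:{ intros; replace (u n - u n) with (0 : C) by ring; apply Cmod_0. }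
apply is_lim_seq_unique in H; rewrite Lim_seq_const in H; injection H; intros E.
replace l with (l - m + m) by ring.
rewrite (Cmod_eq_0 (l - m)) by (symmetry; exact E); ring.
Qed.

Lemma cvg_subseq (u : nat -> C) (l : C) (phi : nat -> nat) :
  (forall K, exists N, forall n, (N <= n)%nat -> (K <= phi n)%nat) ->
  cvg u l -> cvg (fun n => u (phi n)) l.
Proof.
intros Hphi Hu.
apply (filterlim_comp _ _ _ phi (fun n => Cmod (u n - l)) _ eventually);
  [|exact Hu].
intros P [K HK]; destruct (Hphi K) as [N HN]; exists N; intros n Hn.
apply HK, HN, Hn.
Qed.

Lemma cvg_bounded (u : nat -> C) (l : C) : cvg u l ->
  exists B, forall n, (Cmod (u n) <= B)%R.
Proof.
intros H; apply cvg_mod in H.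
destruct (filterlim_bounded (K := R_AbsRing) (V := R_NormedModule)
  (fun n => Cmod (u n))) as [B HB]; [exists (Cmod l); exact H|].
exists B; intros n.
apply Rle_trans with (2 := HB n); apply Rle_abs.
Qed.

Lemma filterlim_cvg (u : nat -> C) (l : C) :
  filterlim u eventually (@locally C_UniformSpace l) -> cvg u l.
Proof.
intros H; apply is_lim_seq_spec; intros eps.
assert (H' := proj1 (filterlim_locally_ball_norm (K := C_AbsRing)
  (U := C_NormedModule) u l) H eps).
revert H'; apply filter_imp; intros n Hn.
rewrite Rminus_0_r, Rabs_pos_eq by apply Cmod_ge_0; exact Hn.
Qed.

Lemma cvg_filterlim (u : nat -> C) (l : C) :
  cvg u l -> filterlim u eventually (@locally C_UniformSpace l).
Proof.
intros H; apply (filterlim_locally_ball_norm (K := C_AbsRing)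
  (U := C_NormedModule) u l); intros eps.
apply is_lim_seq_spec in H; specialize (H eps); revert H.
apply filter_imp; intros n Hn.
rewrite Rminus_0_r, Rabs_pos_eq in Hn by apply Cmod_ge_0; exact Hn.
Qed.

Lemma sum_n_csum (f : nat -> C) n :
  @sum_n C_AbelianMonoid f n = csum f (S n).
Proof.
induction n as [|n IH].
- rewrite sum_O; simpl; ring.
- rewrite sum_Sn, IH; reflexivity.
Qed.

Lemma is_series_csum (f : nat -> C) (l : C) :
  @is_series C_AbsRing C_NormedModule f l <-> cvg (csum f) l.
Proof.
assert (E : forall n, @sum_n C_AbelianMonoid f n = csum f (S n))
  by apply sum_n_csum.
split; intros H.
- apply (is_lim_seq_incr_1 (fun n => Cmod (csum f n - l))), filterlim_cvg.
  apply (filterlim_ext (@sum_n C_AbelianMonoid f)); [exact E|exact H].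
- apply (filterlim_ext (fun n => csum f (S n)));
    [intros; symmetry; apply E|].
  apply cvg_filterlim.
  apply (is_lim_seq_incr_1 (fun n => Cmod (csum f n - l))); exact H.
Qed.

Lemma cvg_pow (x : C) : (Cmod x < 1)%R -> cvg (fun n => x ^ n) 0.
Proof.
intros H; apply cvg_of_bound with (fun n => (Cmod x ^ n)%R).
- intros n; rewrite <- Cmod_pow; apply Req_le; f_equal; ring.
- apply is_lim_seq_geom; rewrite Rabs_pos_eq by apply Cmod_ge_0; exact H.
Qed.

(** * Dominated convergence for sums *)

Fixpoint rsum (f : nat -> R) (n : nat) : R :=
  match n with
  | O => 0%R
  | S m => (rsum f m + f m)%R
  end.

Lemma rsum_le (f g : nat -> R) n :
  (forall k, (k < n)%nat -> (f k <= g k)%R) -> (rsum f n <= rsum g n)%R.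
Proof.
induction n as [|n IH]; intros H; simpl; [lra|].
assert (rsum f n <= rsum g n)%R by (apply IH; intros; apply H; lia).
assert (f n <= g n)%R by (apply H; lia). lra.
Qed.

Lemma rsum_scal (c : R) (f : nat -> R) n :
  rsum (fun k => c * f k)%R n = (c * rsum f n)%R.
Proof. induction n as [|n IH]; simpl; [|rewrite IH]; ring. Qed.

Lemma Cmod_csum (f : nat -> C) n :
  (Cmod (csum f n) <= rsum (fun k => Cmod (f k)) n)%R.
Proof.
induction n as [|n IH]; simpl; [rewrite Cmod_0; lra|].
apply Rle_trans with (1 := Cmod_triangle _ _); lra.
Qed.

Definition summable (B : nat -> R) : Prop :=
  (forall n, (0 <= B n)%R) /\ exists S, forall n, (rsum B n <= S)%R.

Lemma summable_le (A B : nat -> R) :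
  (forall n, (0 <= A n <= B n)%R) -> summable B -> summable A.
Proof.
intros H [_ [S HS]]; split; [intros; apply H|exists S; intros n].
apply Rle_trans with (2 := HS n); apply rsum_le; intros; apply H.
Qed.

Lemma summable_scal (c : R) (B : nat -> R) :
  (0 <= c)%R -> summable B -> summable (fun n => c * B n)%R.
Proof.
intros Hc [H0 [S HS]]; split; [intros; apply Rmult_le_pos; auto|].
exists (c * S)%R; intros n; rewrite rsum_scal.
apply Rmult_le_compat_l; auto.
Qed.

Lemma rsum_incr (B : nat -> R) : (forall n, (0 <= B n)%R) ->
  forall n m, (n <= m)%nat -> (rsum B n <= rsum B m)%R.
Proof.
intros H n m Hnm; induction Hnm as [|m Hnm IH]; [lra|].
simpl; specialize (H m); lra.
Qed.

Lemma summable_tail (B : nat -> R) : summable B ->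
  forall eps, (0 < eps)%R ->
  exists K, forall m, (K <= m)%nat -> (rsum B m - rsum B K < eps)%R.
Proof.
intros [H0 [S HS]] eps Heps.
destruct (ex_finite_lim_seq_incr (rsum B) S) as [l Hl];
  [intros; apply rsum_incr; auto|exact HS|].
assert (Hle : forall n, (rsum B n <= l)%R).
{ intros n; apply (is_lim_seq_incr_compare _ _ Hl).
  intros; apply rsum_incr; auto. }
apply is_lim_seq_spec in Hl; destruct (Hl (mkposreal _ Heps)) as [K HK].
exists K; intros m Hm; specialize (HK K (le_n K)); simpl in HK.
specialize (Hle m). apply Rabs_def2 in HK; lra.
Qed.

(** Tannery's theorem.  Only limits equal to [0] are considered: in the
    applications [f N k] is the error made by replacing a term of a finite
    identity by its limit, so that no infinite sum has to be named. *)
Lemma tannery (f : nat -> nat -> C) (m : nat -> nat) (B : nat -> R) :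
  summable B ->
  (forall N k, (k < m N)%nat -> (Cmod (f N k) <= B k)%R) ->
  (forall k, cvg (fun N => f N k) 0) ->
  cvg (fun N => csum (f N) (m N)) 0.
Proof.
intros HB Hf Hlim.
assert (Hfin : forall K, is_lim_seq (fun N => rsum (fun k => Cmod (f N k)) K) 0%R).
{ induction K as [|K IH]; simpl; [apply is_lim_seq_const|].
  apply is_lim_seq_eq with (0 + 0)%R; [|ring].
  apply is_lim_seq_plus'; [exact IH|].
  apply is_lim_seq_ext with (2 := Hlim K); intros; f_equal; ring. }
assert (Hsplit : forall N K m', (m' <= m N)%nat ->
  (rsum (fun k => Cmod (f N k)) m' <=
   rsum (fun k => Cmod (f N k)) K + (rsum B (max K m') - rsum B K))%R).
{ intros N K m'; induction m' as [|m' IH]; intros Hm.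
  - rewrite Nat.max_0_r; simpl.
    assert (0 <= rsum (fun k => Cmod (f N k)) K)%R; [|lra].
    apply (rsum_incr (fun k => Cmod (f N k)) (fun k => Cmod_ge_0 (f N k)) 0 K); lia.
  - destruct (Nat.le_gt_cases K m') as [H|H].
    + rewrite Nat.max_r in * by lia; simpl.
      specialize (IH ltac:(lia)). specialize (Hf N m' ltac:(lia)). lra.
    + rewrite Nat.max_l by lia.
      assert (Hi := rsum_incr (fun k => Cmod (f N k)) (fun k => Cmod_ge_0 (f N k))
        (S m') K ltac:(lia)). lra. }
apply is_lim_seq_spec; intros eps.
assert (Heps : (0 < eps / 2)%R) by (destruct eps; simpl; lra).
destruct (summable_tail B HB _ Heps) as [K HK].
specialize (Hfin K); apply is_lim_seq_spec in Hfin.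
destruct (Hfin (mkposreal _ Heps)) as [N0 HN0]; exists N0; intros N HN.
specialize (HN0 N HN); simpl in HN0.
rewrite Rminus_0_r in *; rewrite Rabs_pos_eq by apply Cmod_ge_0.
apply Rabs_def2 in HN0.
replace (csum (f N) (m N) - 0) with (csum (f N) (m N)) by ring.
assert (H1 := Cmod_csum (f N) (m N)).
assert (H2 := Hsplit N K (m N) (le_n _)).
specialize (HK (max K (m N)) ltac:(lia)). lra.
Qed.

Lemma summable_cvg (f : nat -> C) :
  summable (fun n => Cmod (f n)) -> exists l, cvg (csum f) l.
Proof.
intros [H0 [S HS]].
assert (H : @ex_series C_AbsRing C_NormedModule f).
{ apply (@ex_series_le C_AbsRing C_CompleteNormedModule f (fun n => Cmod (f n)));
    [intros; apply Rle_refl|].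
  destruct (ex_finite_lim_seq_incr (rsum (fun n => Cmod (f n))) S) as [l Hl];
    [intros; apply rsum_incr; auto|exact HS|].
  exists l; apply is_lim_seq_incr_1 in Hl; revert Hl.
  apply (filterlim_ext (fun n => rsum (fun n => Cmod (f n)) (Datatypes.S n))).
  induction x as [|n IH]; [rewrite sum_O; simpl; ring|].
  rewrite sum_Sn, <- IH; reflexivity. }
destruct H as [l Hl]; exists l; apply is_series_csum; exact Hl.
Qed.

(** Domination by the terms of [sum (k+1) r^k = 1/(1-r)^2] covers all the
    Lambert-type series below. *)
Lemma summable_arith_geom (r : R) : (0 <= r < 1)%R ->
  summable (fun k => INR (S k) * r ^ k)%R.
Proof.
intros Hr; split.
- intros n; apply Rmult_le_pos; [apply pos_INR|apply pow_le; lra].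
- exists (/ (1 - r) ^ 2)%R; intros n.
  assert (E : ((1 - r) ^ 2 * rsum (fun k => INR (S k) * r ^ k) n =
    1 - INR (S n) * r ^ n + INR n * (r * r ^ n))%R).
  { induction n as [|n IH]; [simpl; ring|].
    cbn [rsum]; rewrite Rmult_plus_distr_l, IH, !S_INR; simpl; ring. }
  assert (Hp : (0 <= r ^ n)%R) by (apply pow_le; lra).
  assert (Hn := pos_INR n). rewrite S_INR in E.
  assert (INR n * (r * r ^ n) <= INR n * r ^ n)%R by (apply Rmult_le_compat_l; nra).
  apply Rmult_le_reg_l with ((1 - r) ^ 2)%R; [apply pow_lt; lra|].
  rewrite E, Rinv_r by (apply pow_nonzero; lra). lra.
Qed.

Lemma summable_geom (r : R) : (0 <= r < 1)%R -> summable (fun k => r ^ k)%R.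
Proof.
intros Hr; apply summable_le with (2 := summable_arith_geom r Hr).
intros n; assert (0 <= r ^ n)%R by (apply pow_le; lra).
rewrite S_INR; assert (Hn := pos_INR n). split; [lra|nra].
Qed.
(** * Infinite q-shifted factorials *)

Lemma cvg_qpoch (a q : C) : (Cmod q < 1)%R ->
  cvg (qpoch_fin a q) (qpoch_inf a q).
Proof. intros H; apply filterlim_cvg, qpoch_inf_correct, H. Qed.

Lemma cvg_inv_bounded (u : nat -> C) (l : C) :
  (forall n, u n <> 0) -> l <> 0 -> cvg u l ->
  exists G, forall n, (Cmod (/ u n) <= G)%R.
Proof. intros Hn Hl H; eapply cvg_bounded, cvg_inv; eassumption. Qed.

Lemma cvg_one_minus (a q : C) : (Cmod q < 1)%R -> cvg (fun n => 1 - a * q ^ n) 1.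
Proof.
intros H; apply cvg_eq with (1 - a * 0); [|ring].
apply cvg_minus; [apply cvg_const|apply cvg_scal, cvg_pow, H].
Qed.

Lemma one_minus_inv_bounded (a q : C) : (Cmod q < 1)%R ->
  (forall n, 1 - a * q ^ n <> 0) ->
  exists G, forall n, (Cmod (/ (1 - a * q ^ n)) <= G)%R.
Proof.
intros Hq Hn; apply cvg_inv_bounded with (1 : C);
  [exact Hn|exact C1_nz|apply cvg_one_minus, Hq].
Qed.

(** The reciprocals of the partial products are bounded, since
    [1/(1 - x) = 1 + x/(1 - x)]; hence the limit cannot vanish. *)
Lemma qpoch_inf_neq_0 (a q : C) : (Cmod q < 1)%R ->
  (forall n, 1 - a * q ^ n <> 0) -> qpoch_inf a q <> 0.
Proof.
intros Hq Hn.
destruct (one_minus_inv_bounded a q Hq Hn) as [G HG].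
assert (HG0 : (0 <= G)%R)
  by (apply Rle_trans with (2 := HG O); apply Cmod_ge_0).
assert (Hq0 := Cmod_ge_0 q).
destruct (summable_scal (Cmod a * G) _
  (Rmult_le_pos _ _ (Cmod_ge_0 a) HG0)
  (summable_geom (Cmod q) (conj Hq0 Hq))) as [_ [T HT]].
assert (Hinv : forall n, (Cmod (/ qpoch_fin a q n) <= exp T)%R).
{ intros n; apply Rle_trans with
    (exp (rsum (fun k => Cmod a * G * Cmod q ^ k) n))%R.
  - induction n as [|n IH]; cbn [qpoch_fin rsum].
    + rewrite exp_0; replace (/ 1) with (1 : C) by (field; exact C1_nz).
      rewrite Cmod_1; lra.
    + rewrite exp_plus.
      replace (/ (qpoch_fin a q n * (1 - a * q ^ n)))
        with (/ qpoch_fin a q n * (1 + a * q ^ n * / (1 - a * q ^ n))).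
      2:{ field; split; [apply Hn|]. apply qpoch_fin_neq_0; intros; apply Hn. }
      rewrite Cmod_mult; apply Rmult_le_compat; try apply Cmod_ge_0; [exact IH|].
      apply Rle_trans with (1 := Cmod_triangle _ _).
      rewrite Cmod_1, !Cmod_mult, Cmod_pow.
      eapply Rle_trans; [|apply exp_ineq1_le].
      apply Rplus_le_compat_l.
      replace (Cmod a * G * Cmod q ^ n)%R with (Cmod a * Cmod q ^ n * G)%R by ring.
      apply Rmult_le_compat_l; [|apply HG].
      apply Rmult_le_pos; [apply Cmod_ge_0|apply pow_le; lra].
  - specialize (HT n); destruct HT as [HT|HT];
      [left; apply exp_increasing, HT|rewrite HT; apply Rle_refl]. }
assert (He := exp_pos T).
assert (H := cvg_mod _ _ (cvg_qpoch a q Hq)).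
intros E; rewrite E, Cmod_0 in H.
assert (He' : (0 < / exp T)%R) by (apply Rinv_0_lt_compat; lra).
assert (Hle : (/ exp T <= 0)%R); [|lra].
refine (is_lim_seq_le (fun _ => / exp T)%R _ (/ exp T)%R 0%R _
  (is_lim_seq_const _) H).
intros n; specialize (Hinv n).
assert (Hnz : qpoch_fin a q n <> 0) by (apply qpoch_fin_neq_0; intros; apply Hn).
rewrite Cmod_inv in Hinv by exact Hnz.
apply Cmod_gt_0 in Hnz.
apply Rmult_le_reg_r with (exp T); [exact He|]. rewrite Rinv_l by lra.
apply Rmult_le_reg_l with (/ Cmod (qpoch_fin a q n))%R;
  [apply Rinv_0_lt_compat; lra|].
rewrite <- Rmult_assoc, Rinv_l by lra. lra.
Qed.

Lemma one_minus_neq_0 (x : C) : (Cmod x < 1)%R -> 1 - x <> 0.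
Proof.
intros H E.
assert (E' : x = 1) by (replace x with (1 - (1 - x)) by ring; rewrite E; ring).
rewrite E', Cmod_1 in H; lra.
Qed.

Lemma Cmod_mult_pow_lt (a q : C) n :
  (Cmod a < 1)%R -> (Cmod q < 1)%R -> (Cmod (a * q ^ n) < 1)%R.
Proof.
intros Ha Hq; rewrite Cmod_mult, Cmod_pow.
assert (H := Cmod_ge_0 a); assert (H' := Cmod_ge_0 q).
assert (0 <= Cmod q ^ n)%R by (apply pow_le; lra).
assert (Cmod q ^ n <= 1)%R
  by (rewrite <- (pow1 n); apply pow_incr; lra).
nra.
Qed.

Lemma one_minus_mult_pow_neq_0 (a q : C) :
  (Cmod a < 1)%R -> (Cmod q < 1)%R -> forall n, 1 - a * q ^ n <> 0.
Proof. intros Ha Hq n; apply one_minus_neq_0, Cmod_mult_pow_lt; assumption. Qed.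

(** * Kronecker's bilateral sum *)

(** [b] stays away from the integral powers of [p]; the involution [b -> p/b]
    exchanges the non-negative and the negative powers. *)
Definition off_powers (b b' p : C) : Prop :=
  b * b' = p /\ (forall n, 1 - b * p ^ n <> 0) /\ (forall n, 1 - b' * p ^ n <> 0).

(** The term [a^j / (1 - b p^j)] with [j = i - N]: the window [i < 2N + 1] of
    natural numbers stands for [-N <= j <= N]. *)
Definition kronecker_term (a b p : C) (N i : nat) : C :=
  a ^ i / a ^ N * / (1 - b / p ^ N * p ^ i).

Lemma window_right (b p : C) N n : p <> 0 ->
  b / p ^ N * p ^ (N + n) = b * p ^ n.
Proof.
intros Hp; rewrite Cpow_add_r; field; apply Cpow_nz, Hp.
Qed.

Lemma window_left (b b' p : C) N n : p <> 0 -> b * b' = p -> (n < N)%nat ->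
  b / p ^ N * p ^ (N - 1 - n) = / (b' * p ^ n).
Proof.
intros Hp Hb Hn.
assert (b' <> 0) by (intros E; apply Hp; rewrite <- Hb, E; ring).
replace (p ^ N) with (p ^ (N - 1 - n) * p ^ n * (b * b')).
- assert (b <> 0) by (intros E; apply Hp; rewrite <- Hb, E; ring).
  field; repeat split; auto; apply Cpow_nz, Hp.
- rewrite Hb, <- Cpow_add_r, Cmult_comm, <- Cpow_S; f_equal; lia.
Qed.

Lemma window_cases (P : nat -> Prop) N :
  (forall n, P (N + n)%nat) -> (forall n, (n < N)%nat -> P (N - 1 - n)%nat) ->
  forall i, P i.
Proof.
intros Hr Hl i; destruct (Nat.le_gt_cases N i) as [H|H].
- replace i with (N + (i - N))%nat by lia; apply Hr.
- replace i with (N - 1 - (N - 1 - i))%nat by lia; apply Hl; lia.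
Qed.

Lemma one_minus_inv_neq_0 (x : C) : x <> 0 -> 1 - x <> 0 -> 1 - / x <> 0.
Proof.
intros Hx H E; apply H; replace (1 - x) with (- x * (1 - / x)) by (field; exact Hx).
rewrite E; ring.
Qed.

Lemma off_powers_neq_0 (b b' p : C) : p <> 0 -> off_powers b b' p ->
  b <> 0 /\ b' <> 0.
Proof.
intros Hp [Hb _]; split; intros E; apply Hp; rewrite <- Hb, E; ring.
Qed.

Lemma window_neq_0 (b b' p : C) N : p <> 0 -> off_powers b b' p ->
  forall i, 1 - b / p ^ N * p ^ i <> 0.
Proof.
intros Hp Hb; destruct (off_powers_neq_0 _ _ _ Hp Hb) as [Hb0 Hb0'].
destruct Hb as (Hb & Hr & Hl).
apply (window_cases _ N); intros n.
- rewrite window_right by exact Hp; apply Hr.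
- intros Hn; rewrite (window_left b b') by auto.
  apply one_minus_inv_neq_0; [apply Cmult_neq_0; [|apply Cpow_nz]|]; auto.
Qed.

Lemma kronecker_term_right (a b p : C) N n : p <> 0 -> a <> 0 ->
  kronecker_term a b p N (N + n) = a ^ n * / (1 - b * p ^ n).
Proof.
intros Hp Ha; unfold kronecker_term; rewrite window_right by exact Hp.
f_equal; rewrite Cpow_add_r; field; apply Cpow_nz, Ha.
Qed.

Lemma kronecker_term_left (a a' b b' p : C) N n :
  p <> 0 -> a * a' = p -> off_powers b b' p -> (n < N)%nat ->
  kronecker_term a b p N (N - 1 - n) =
  - (a' * / b) * (a' ^ n * / (1 - b' * p ^ n)).
Proof.
intros Hp Ha Hb Hn; unfold kronecker_term.
assert (Hb' := off_powers_neq_0 _ _ _ Hp Hb).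
assert (Ha0 : a <> 0) by (intros E; apply Hp; rewrite <- Ha, E; ring).
destruct Hb as (Hb & _ & Hl).
rewrite (window_left b b') by auto.
assert (H1 := Hl n). assert (H2 := Cpow_nz p n Hp).
assert (H3 : b' * p ^ n - 1 <> 0).
{ intros E; apply H1; replace (1 - b' * p ^ n) with (- (b' * p ^ n - 1)) by ring.
  rewrite E; ring. }
replace (a ^ N) with (a ^ (N - 1 - n) * a ^ n * a)
  by (rewrite <- Cpow_add_r, Cmult_comm, <- Cpow_S; f_equal; lia).
assert (H4 := Cpow_nz a n Ha0). assert (H5 := Cpow_nz a (N - 1 - n) Ha0).
replace (p ^ n) with (a ^ n * a' ^ n) in * by (rewrite <- Cpow_mult_l, Ha; reflexivity).
assert (Ha' : a' ^ n <> 0) by (intros E; apply H2; rewrite E; ring).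
transitivity (- (b' / a) * (a' ^ n / (1 - b' * (a ^ n * a' ^ n)))).
- field; repeat split; tauto.
- replace (b' / a) with (a' / b); [unfold Cdiv; ring|].
  transitivity (p / (a * b)); [rewrite <- Ha|rewrite <- Hb]; field; tauto.
Qed.

Lemma kronecker_term_bound (a a' b b' p : C) (r : R) :
  p <> 0 -> (Cmod p < 1)%R -> a * a' = p -> off_powers b b' p ->
  (Cmod a <= r)%R -> (Cmod a' <= r)%R ->
  exists D, (0 <= D)%R /\ forall N n,
   (Cmod (kronecker_term a b p N (N + n)) <= D * r ^ n)%R /\
   ((n < N)%nat -> (Cmod (kronecker_term a b p N (N - 1 - n)) <= D * r ^ n)%R).
Proof.
intros Hp Hp1 Ha Hb Har Har'.
assert (Ha0 : a <> 0) by (intros E; apply Hp; rewrite <- Ha, E; ring).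
destruct (one_minus_inv_bounded b p Hp1) as [G HG]; [apply Hb|].
destruct (one_minus_inv_bounded b' p Hp1) as [G' HG']; [apply Hb|].
assert (HG0 : (0 <= G)%R) by (apply Rle_trans with (2 := HG O), Cmod_ge_0).
assert (HG0' : (0 <= G')%R) by (apply Rle_trans with (2 := HG' O), Cmod_ge_0).
set (e := Cmod (- (a' * / b))).
assert (He : (0 <= e)%R) by apply Cmod_ge_0.
assert (H0 := Cmod_ge_0 a). assert (H0' := Cmod_ge_0 a').
exists (G + e * G')%R; split; [nra|]; intros N n.
assert (Hpow : forall x, (Cmod x <= r)%R -> (Cmod (x ^ n) <= r ^ n)%R).
{ intros x Hx; rewrite Cmod_pow; apply pow_incr; split; [apply Cmod_ge_0|exact Hx]. }
assert (Hr : (0 <= r ^ n)%R) by (apply pow_le; lra).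
assert (0 <= e * G')%R by (apply Rmult_le_pos; auto).
split; [|intros Hn].
- rewrite kronecker_term_right, Cmod_mult by auto.
  apply Rle_trans with (r ^ n * G)%R; [|nra].
  apply Rmult_le_compat; auto; apply Cmod_ge_0.
- rewrite (kronecker_term_left a a' b b'), Cmod_mult by auto; fold e.
  apply Rle_trans with (e * (r ^ n * G'))%R; [|nra].
  apply Rmult_le_compat_l; [exact He|]; rewrite Cmod_mult.
  apply Rmult_le_compat; auto; apply Cmod_ge_0.
Qed.

Lemma cvg_shift (u : nat -> C) (l : C) k :
  cvg (fun n => u (n + k)%nat) l -> cvg u l.
Proof. apply (is_lim_seq_incr_n (fun n => Cmod (u n - l)) k). Qed.

Lemma tannery_window (f : nat -> nat -> C) (B : nat -> R) :
  summable B ->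
  (forall N n, (n < N + 1)%nat -> (Cmod (f N (N + n)%nat) <= B n)%R) ->
  (forall N n, (n < N)%nat -> (Cmod (f N (N - 1 - n)%nat) <= B n)%R) ->
  (forall n, cvg (fun N => f N (N + n)%nat) 0) ->
  (forall n, cvg (fun N => f N (N - 1 - n)%nat) 0) ->
  cvg (fun N => csum (f N) (2 * N + 1)) 0.
Proof.
intros HB Hr Hl Hcr Hcl.
apply (cvg_ext (fun N => csum (fun n => f N (N + n)%nat) (N + 1) +
   csum (fun n => f N (N - 1 - n)%nat) N)).
{ intros; symmetry; apply csum_central. }
apply cvg_eq with (0 + 0); [|ring].
apply cvg_plus.
- apply (tannery (fun N n => f N (N + n)%nat) (fun N => N + 1)%nat B); auto.
- apply (tannery (fun N n => f N (N - 1 - n)%nat) (fun N => N) B); auto.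
Qed.

Lemma kronecker_truncated (a a' b b' p : C) N :
  p <> 0 -> a * a' = p -> (forall n, 1 - p ^ S n <> 0) -> off_powers b b' p ->
  csum (fun i => qpoch_fin a' p i / qpoch_fin p p i *
     (qpoch_fin a p (2 * N - i) / qpoch_fin p p (2 * N - i)) *
     kronecker_term a b p N i) (2 * N + 1) =
  qpoch_fin (a * b) p N * qpoch_fin (a' / b) p N /
  (qpoch_fin b p (N + 1) * qpoch_fin b' p N).
Proof.
intros Hp Ha Hpn Hb.
assert (Hw := window_neq_0 b b' p N Hp Hb).
destruct (off_powers_neq_0 _ _ _ Hp Hb) as [Hb0 Hb0'].
assert (Ha0 : a <> 0) by (intros E; apply Hp; rewrite <- Ha, E; ring).
assert (HaN := Cpow_nz a N Ha0). assert (HpN := Cpow_nz p N Hp).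
assert (Hpp : forall n, qpoch_fin p p n <> 0)
  by (intros; apply qpoch_fin_neq_0; intros k _; apply (Hpn k)).
rewrite (csum_ext _ (fun k => / a ^ N *
  (kronecker_coef a a' p (2 * N) k / (1 - b / p ^ N * p ^ k)))).
2:{ intros k _; unfold kronecker_term, kronecker_coef.
    specialize (Hw k). set (c := b / p ^ N) in *. field; auto. }
rewrite csum_scal, Nat.add_1_r.
rewrite kronecker_partial_fractions by auto.
replace (S (2 * N)) with (N + (N + 1))%nat by lia.
replace (2 * N)%nat with (N + N)%nat by lia.
rewrite (qpoch_fin_add _ _ N N), (qpoch_fin_add _ _ N (N + 1)).
assert (R := qpoch_fin_reverse p (a * b) b N Hp (Cmult_neq_0 _ _ Ha0 Hb0) Hb0).
assert (HqN : qpoch_fin (b / p ^ N) p N <> 0)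
  by (apply qpoch_fin_neq_0; intros; apply Hw).
destruct Hb as (Hb & Hr & Hl).
replace (p / b) with b' in R by (rewrite <- Hb; field; exact Hb0).
replace (p / (a * b)) with (a' / b) in R by (rewrite <- Ha; field; auto).
rewrite Cpow_mult_l in R.
replace (a * (b / p ^ N)) with (a * b / p ^ N) by (field; exact HpN).
replace (a * b / p ^ N * p ^ N) with (a * b) by (field; exact HpN).
replace (b / p ^ N * p ^ N) with b by (field; exact HpN).
assert (H1 : qpoch_fin b' p N <> 0) by (apply qpoch_fin_neq_0; intros; apply Hl).
assert (H2 : qpoch_fin b p (N + 1) <> 0) by (apply qpoch_fin_neq_0; intros; apply Hr).
assert (HbN := Cpow_nz b N Hb0).
set (c := b / p ^ N) in *.
transitivity (qpoch_fin (a * b / p ^ N) p N * b ^ N * qpoch_fin b' p N *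
   (qpoch_fin (a * b) p N /
    (a ^ N * b ^ N * qpoch_fin b' p N * qpoch_fin c p N * qpoch_fin b p (N + 1)))).
- field; repeat split; auto.
- rewrite R; field; repeat split; auto.
Qed.

(** Kronecker's formula: the bilateral sum is a quotient of theta functions.
    It is the limit of [kronecker_truncated]: at a fixed distance from the
    centre of the window the coefficients tend to a common limit, and the
    geometric decay of the terms in both directions allows the passage to the
    limit under the sum. *)
Lemma kronecker_sum (a a' b b' p : C) :
  p <> 0 -> (Cmod p < 1)%R -> a * a' = p -> (Cmod a < 1)%R -> (Cmod a' < 1)%R ->
  off_powers b b' p ->
  cvg (fun N => csum (kronecker_term a b p N) (2 * N + 1))
   (qpoch_inf p p ^ 2 * qpoch_inf (a * b) p * qpoch_inf (a' / b) p /
    (qpoch_inf a p * qpoch_inf a' p * qpoch_inf b p * qpoch_inf b' p)).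
Proof.
intros Hp Hp1 Ha Ha1 Ha1' Hb.
assert (Hpn := one_minus_mult_pow_neq_0 p p Hp1 Hp1).
assert (HP : qpoch_inf p p <> 0) by (apply qpoch_inf_neq_0; auto).
assert (HPn : forall n, qpoch_fin p p n <> 0)
  by (intros; apply qpoch_fin_neq_0; auto).
assert (HA : qpoch_inf a p <> 0)
  by (apply qpoch_inf_neq_0, one_minus_mult_pow_neq_0; auto).
assert (HA' : qpoch_inf a' p <> 0)
  by (apply qpoch_inf_neq_0, one_minus_mult_pow_neq_0; auto).
assert (HB : qpoch_inf b p <> 0) by (apply qpoch_inf_neq_0; [auto|apply Hb]).
assert (HB' : qpoch_inf b' p <> 0) by (apply qpoch_inf_neq_0; [auto|apply Hb]).
assert (Hq := fun x => cvg_qpoch x p Hp1).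
set (u := fun n => qpoch_fin a' p n / qpoch_fin p p n).
set (v := fun n => qpoch_fin a p n / qpoch_fin p p n).
set (U := qpoch_inf a' p / qpoch_inf p p).
set (V := qpoch_inf a p / qpoch_inf p p).
assert (Hu : cvg u U) by (apply cvg_div; auto).
assert (Hv : cvg v V) by (apply cvg_div; auto).
destruct (cvg_bounded _ _ Hu) as [Bu HBu].
destruct (cvg_bounded _ _ Hv) as [Bv HBv].
set (r := Rmax (Cmod a) (Cmod a')).
assert (Hr : (0 <= r < 1)%R).
{ split; [apply Rle_trans with (1 := Cmod_ge_0 a), Rmax_l|].
  apply Rmax_lub_lt; assumption. }
destruct (kronecker_term_bound a a' b b' p r Hp Hp1 Ha Hb) as [D [HD HDb]];
  [apply Rmax_l|apply Rmax_r|].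
set (E := (Bu * Bv + Cmod (U * V))%R).
assert (HE : forall i j, (Cmod (u i * v j - U * V) <= E)%R).
{ intros i j; unfold E, Cminus.
  apply Rle_trans with (1 := Cmod_triangle _ _).
  rewrite Cmod_opp; apply Rplus_le_compat_r; rewrite Cmod_mult.
  apply Rmult_le_compat; auto; apply Cmod_ge_0. }
assert (HE0 : (0 <= E)%R) by (apply Rle_trans with (2 := HE O O), Cmod_ge_0).
assert (Ha0 : a <> 0) by (intros e; apply Hp; rewrite <- Ha, e; ring).
assert (Huv : forall phi phi' : nat -> nat,
  (forall K, exists N, forall n, (N <= n)%nat -> (K <= phi n)%nat) ->
  (forall K, exists N, forall n, (N <= n)%nat -> (K <= phi' n)%nat) ->
  cvg (fun N => u (phi N) * v (phi' N) - U * V) 0).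
{ intros phi phi' H H'; apply cvg_eq with (U * V - U * V); [|ring].
  apply cvg_minus; [|apply cvg_const].
  apply cvg_mult; apply cvg_subseq; auto. }
assert (Hdiff : cvg (fun N => csum (fun i =>
  (u i * v (2 * N - i)%nat - U * V) * kronecker_term a b p N i) (2 * N + 1)) 0).
{ apply (tannery_window _ (fun n => E * D * r ^ n)%R).
  - apply summable_scal, summable_geom; [|exact Hr].
    apply Rmult_le_pos; assumption.
  - intros N n _; rewrite Cmod_mult, Rmult_assoc.
    apply Rmult_le_compat; try apply Cmod_ge_0; [apply HE|apply HDb].
  - intros N n Hn; rewrite Cmod_mult, Rmult_assoc.
    apply Rmult_le_compat; try apply Cmod_ge_0; [apply HE|apply HDb, Hn].
  - intros n.
    apply (cvg_ext (fun N => (u (N + n)%nat * v (2 * N - (N + n))%nat - U * V) *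
      (a ^ n * / (1 - b * p ^ n)))).
    { intros; rewrite kronecker_term_right by auto; reflexivity. }
    apply cvg_eq with (0 * (a ^ n * / (1 - b * p ^ n))); [|ring].
    apply cvg_mult; [|apply cvg_const].
    apply (Huv (fun N => N + n)%nat (fun N => 2 * N - (N + n))%nat);
      intros K; exists (K + n)%nat; intros; lia.
  - intros n; apply (cvg_shift _ _ (S n)).
    apply (cvg_ext (fun N => (u (N + S n - 1 - n)%nat *
      v (2 * (N + S n) - (N + S n - 1 - n))%nat - U * V) *
      (- (a' * / b) * (a' ^ n * / (1 - b' * p ^ n))))).
    { intros; rewrite (kronecker_term_left a a' b b') by (auto; lia); reflexivity. }
    match goal with |- cvg (fun N => _ * ?x) _ =>
      apply cvg_eq with (0 * x); [|ring] end.
    apply cvg_mult; [|apply cvg_const].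
    apply (Huv (fun N => N + S n - 1 - n)%nat
      (fun N => 2 * (N + S n) - (N + S n - 1 - n))%nat);
      intros K; exists K; intros; lia. }
assert (HL : cvg (fun N => qpoch_fin (a * b) p N * qpoch_fin (a' / b) p N /
  (qpoch_fin b p (N + 1) * qpoch_fin b' p N))
  (qpoch_inf (a * b) p * qpoch_inf (a' / b) p / (qpoch_inf b p * qpoch_inf b' p))).
{ apply cvg_div.
  - intros n; apply Cmult_neq_0; apply qpoch_fin_neq_0; intros; apply Hb.
  - apply Cmult_neq_0; assumption.
  - apply cvg_mult; apply Hq.
  - apply cvg_mult; [|apply Hq].
    apply (cvg_subseq (qpoch_fin b p) _ (fun N => N + 1)%nat); [|apply Hq].
    intros K; exists K; intros; lia. }
assert (HUV : U * V <> 0).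
{ unfold U, V; intros e.
  apply (Cmult_neq_0 _ _ HA' HA).
  replace (qpoch_inf a' p * qpoch_inf a p) with
    (qpoch_inf a' p / qpoch_inf p p * (qpoch_inf a p / qpoch_inf p p) *
     qpoch_inf p p * qpoch_inf p p) by (field; exact HP).
  rewrite e; ring. }
assert (H := cvg_scal (/ (U * V)) _ _ (cvg_minus _ _ _ _ HL Hdiff)).
apply (cvg_ext _ (fun N => csum (kronecker_term a b p N) (2 * N + 1))) in H.
- apply cvg_eq with (1 := H); unfold U, V; field; auto.
- intros N; rewrite <- (kronecker_truncated a a' b b' p N) by auto.
  rewrite <- csum_minus, <- csum_scal; apply csum_ext; intros k _.
  fold (u k) (v (2 * N - k)%nat). field.
  split; intros e; apply HUV; rewrite e; ring.
Qed.
(** * The product of two Kronecker sums *)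

Lemma csum_const (c : C) n : csum (fun _ => c) n = RtoC (INR n) * c.
Proof.
induction n as [|n IH]; [simpl; ring|].
cbn [csum]; rewrite IH, S_INR, RtoC_plus; ring.
Qed.

Lemma cvg_csum (f : nat -> nat -> C) (l : nat -> C) k :
  (forall i, (i < k)%nat -> cvg (fun N => f N i) (l i)) ->
  cvg (fun N => csum (f N) k) (csum l k).
Proof.
induction k as [|k IH]; intros H; simpl; [apply cvg_const|].
apply cvg_plus; [apply IH; intros; apply H|apply H]; lia.
Qed.

Lemma Cmod_csum_le (f : nat -> C) (c : R) n :
  (forall k, (k < n)%nat -> (Cmod (f k) <= c)%R) ->
  (Cmod (csum f n) <= INR n * c)%R.
Proof.
induction n as [|n IH]; intros H; cbn [csum].
- rewrite Cmod_0; simpl; lra.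
- rewrite S_INR; apply Rle_trans with (1 := Cmod_triangle _ _).
  specialize (IH ltac:(intros; apply H; lia)). specialize (H n ltac:(lia)). lra.
Qed.

Lemma window_kernel (b p : C) N i :
  kronecker_term 1 b p N i = / (1 - b / p ^ N * p ^ i).
Proof.
unfold kronecker_term; rewrite !Cpow_1_l.
replace (1 / 1) with (1 : C) by (field; exact C1_nz); ring.
Qed.

Lemma window_kernel_bounded (b b' p : C) :
  p <> 0 -> (Cmod p < 1)%R -> off_powers b b' p ->
  exists G, forall N i, (Cmod (/ (1 - b / p ^ N * p ^ i)) <= G)%R.
Proof.
intros Hp Hp1 Hb.
destruct (kronecker_term_bound 1 p b b' p 1 Hp Hp1) as [D [HD H]];
  [ring|exact Hb|rewrite Cmod_1; lra|lra|].
exists D; intros N.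
apply (window_cases _ N); intros n; specialize (H N n);
  rewrite <- window_kernel; rewrite pow1, Rmult_1_r in H; apply H.
Qed.

(** The kernel [1/(1 - b p^j)] tends to [0] as [j -> -oo] and to [1] as
    [j -> +oo]; this is all that the telescoped differences retain. *)
Lemma window_kernel_left (b b' p : C) i :
  p <> 0 -> (Cmod p < 1)%R -> off_powers b b' p ->
  cvg (fun N => / (1 - b / p ^ N * p ^ i)) 0.
Proof.
intros Hp Hp1 Hb.
assert (Hb0 := proj1 (off_powers_neq_0 _ _ _ Hp Hb)).
assert (Hi := Cpow_nz p i Hp).
assert (Hden : forall N, p ^ N - b * p ^ i <> 0).
{ intros N E; apply (window_neq_0 b b' p N Hp Hb i).
  replace (1 - b / p ^ N * p ^ i) with ((p ^ N - b * p ^ i) / p ^ N)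
    by (field; apply Cpow_nz, Hp).
  rewrite E; unfold Cdiv; ring. }
apply (cvg_ext (fun N => p ^ N / (p ^ N - b * p ^ i))).
{ intros N; assert (HN := Cpow_nz p N Hp).
  assert (Hw := window_neq_0 b b' p N Hp Hb i). specialize (Hden N).
  field; repeat split; auto. }
assert (Hlim : - (b * p ^ i) <> 0).
{ intros E; apply (Cmult_neq_0 _ _ Hb0 Hi).
  replace (b * p ^ i) with (- - (b * p ^ i)) by ring; rewrite E; ring. }
apply cvg_eq with (0 / (- (b * p ^ i))); [|unfold Cdiv; ring].
apply cvg_div; [exact Hden|exact Hlim|apply cvg_pow, Hp1|].
apply cvg_eq with (0 - b * p ^ i); [|ring].
apply cvg_minus; [apply cvg_pow, Hp1|apply cvg_const].
Qed.

Lemma window_kernel_right (b b' p : C) i :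
  p <> 0 -> (Cmod p < 1)%R -> off_powers b b' p ->
  cvg (fun N => / (1 - b / p ^ N * p ^ (2 * N - i))) 1.
Proof.
intros Hp Hp1 Hb; apply (cvg_shift _ _ i).
apply (cvg_ext (fun N => / (1 - b * p ^ N))).
{ intros N; replace (2 * (N + i) - i)%nat with (N + i + N)%nat by lia.
  rewrite window_right by exact Hp; reflexivity. }
apply cvg_eq with (/ 1); [|field; exact C1_nz].
apply cvg_inv; [apply Hb|exact C1_nz|apply cvg_one_minus, Hp1].
Qed.

Lemma Cmod_pow_S_le (x : C) (r : R) k : (Cmod x <= r)%R -> (r < 1)%R ->
  (Cmod (x ^ S k) <= r ^ k)%R.
Proof.
intros Hx Hr; rewrite Cmod_pow; assert (H0 := Cmod_ge_0 x).
simpl; assert (Cmod x ^ k <= r ^ k)%R by (apply pow_incr; lra).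
assert (0 <= Cmod x ^ k)%R by (apply pow_le; lra). nra.
Qed.

(** For a fixed difference [k + 1] of the indices the telescoped sum consists of
    [k + 1] kernels from the left end of the window minus as many from the right
    end, so it tends to [- (k + 1)]. *)
Lemma off_diagonal_sum (a a' b b' p : C) :
  p <> 0 -> (Cmod p < 1)%R -> (Cmod a < 1)%R -> (Cmod a' < 1)%R ->
  off_powers b b' p ->
  let g N i := / (1 - b / p ^ N * p ^ i) in
  cvg (fun N => csum (fun k => lambert_weight a a' p (S k) *
      (csum (fun i => g N i - g N (i + S k)%nat) (2 * N + 1 - S k)
       + RtoC (INR (S k)))) (2 * N + 1)) 0.
Proof.
intros Hp Hp1 Ha1 Ha1' Hb g.
destruct (window_kernel_bounded b b' p Hp Hp1 Hb) as [G HG].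
assert (HG0 : (0 <= G)%R) by (apply Rle_trans with (2 := HG O O), Cmod_ge_0).
destruct (one_minus_inv_bounded p p Hp1
  (one_minus_mult_pow_neq_0 p p Hp1 Hp1)) as [Gp HGp].
assert (HGp0 : (0 <= Gp)%R) by (apply Rle_trans with (2 := HGp O), Cmod_ge_0).
set (r := Rmax (Cmod a) (Cmod a')).
assert (Hr : (0 <= r < 1)%R).
{ split; [apply Rle_trans with (1 := Cmod_ge_0 a), Rmax_l|].
  apply Rmax_lub_lt; assumption. }
apply (tannery _ (fun N => 2 * N + 1)%nat
  (fun k => 2 * Gp * (2 * G + 1) * (INR (S k) * r ^ k))%R).
- apply summable_scal; [|apply summable_arith_geom, Hr].
  apply Rmult_le_pos; lra.
- intros N k Hk; rewrite csum_telescope, Cmod_mult by lia.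
  replace (2 * Gp * (2 * G + 1) * (INR (S k) * r ^ k))%R with
    (2 * r ^ k * Gp * (INR (S k) * (2 * G) + INR (S k)))%R by ring.
  apply Rmult_le_compat; try apply Cmod_ge_0.
  + unfold lambert_weight, Cdiv; rewrite Cmod_mult.
    apply Rmult_le_compat; try apply Cmod_ge_0; [|apply HGp].
    apply Rle_trans with (1 := Cmod_triangle _ _).
    assert (H1 := Cmod_pow_S_le a r k (Rmax_l _ _) (proj2 Hr)).
    assert (H2 := Cmod_pow_S_le a' r k (Rmax_r _ _) (proj2 Hr)). lra.
  + apply Rle_trans with (1 := Cmod_triangle _ _).
    rewrite Cmod_R, Rabs_pos_eq by apply pos_INR.
    apply Rplus_le_compat_r, Cmod_csum_le; intros i _.
    apply Rle_trans with (1 := Cmod_triangle _ _); rewrite Cmod_opp.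
    assert (H1 := HG N i). assert (H2 := HG N (2 * N + 1 - 1 - i)%nat).
    unfold g; lra.
- intros k; apply (cvg_shift _ _ k).
  apply (cvg_ext (fun n => lambert_weight a a' p (S k) *
    (csum (fun i => g (n + k)%nat i - g (n + k)%nat (2 * (n + k) - i)%nat) (S k)
     + RtoC (INR (S k))))).
  { intros n; rewrite csum_telescope by lia; f_equal; f_equal.
    apply csum_ext; intros i _; do 2 f_equal; f_equal; lia. }
  apply cvg_eq with (lambert_weight a a' p (S k) *
    (csum (fun _ => 0 - 1) (S k) + RtoC (INR (S k)))).
  2:{ rewrite csum_const; ring. }
  apply cvg_scal, cvg_plus; [|apply cvg_const].
  apply (cvg_csum (fun n i => g (n + k)%nat i - g (n + k)%nat (2 * (n + k) - i)%nat)).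
  intros i _.
  apply (cvg_subseq (fun N => g N i - g N (2 * N - i)%nat) _ (fun n => n + k)%nat).
  { intros K; exists K; intros; lia. }
  apply cvg_minus;
    [apply (window_kernel_left b b')|apply (window_kernel_right b b')]; auto.
Qed.

(** * Lambert series *)

Lemma csum_geom (x : C) n : (1 - x) * csum (fun j => x ^ j) n = 1 - x ^ n.
Proof.
induction n as [|n IH]; [simpl; ring|].
cbn [csum]; rewrite Cmult_plus_distr_l, IH, Cpow_S; ring.
Qed.

Lemma csum_arith_geom (x : C) n : 1 - x <> 0 ->
  csum (fun k => RtoC (INR (S k)) * x ^ S k) n =
  koebe x - x * (x ^ n * (RtoC (INR (S n)) - RtoC (INR n) * x)) / (1 - x) ^ 2.
Proof.
intros Hx; unfold koebe; induction n as [|n IH].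
- simpl; field; exact Hx.
- cbn [csum]; rewrite IH, !S_INR, !RtoC_plus, !Cpow_S; field; exact Hx.
Qed.

Lemma arith_geom_bounded (r : R) : (0 <= r < 1)%R ->
  exists T, forall n, (INR (S n) * r ^ n <= T)%R.
Proof.
intros Hr; destruct (summable_arith_geom r Hr) as [H0 [T HT]].
exists T; intros n; apply Rle_trans with (2 := HT (S n)); cbn [rsum].
assert (H := rsum_incr _ H0 0 n ltac:(lia)); simpl (rsum _ 0) in H. lra.
Qed.

Lemma arith_geom_null (r : R) : (0 <= r < 1)%R ->
  is_lim_seq (fun n => INR (S n) * r ^ n)%R 0.
Proof.
intros Hr; destruct (summable_arith_geom r Hr) as [H0 [T HT]].
destruct (ex_finite_lim_seq_incr (rsum (fun k => INR (S k) * r ^ k)%R) T) as [l Hl];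
  [intros; apply rsum_incr; auto|exact HT|].
apply (is_lim_seq_ext (fun n => rsum (fun k => INR (S k) * r ^ k)%R (S n) -
   rsum (fun k => INR (S k) * r ^ k)%R n)%R); [intros; cbn [rsum]; ring|].
apply is_lim_seq_eq with (l - l)%R; [|ring].
apply is_lim_seq_minus'; [apply (is_lim_seq_incr_1 (rsum _))|]; exact Hl.
Qed.

Lemma arith_geom_error (x : C) (r : R) n : (Cmod x <= r < 1)%R ->
  (Cmod (x * (x ^ n * (RtoC (INR (S n)) - RtoC (INR n) * x)) / (1 - x) ^ 2) <=
   Cmod x * (INR (S n) * r ^ n) * (2 / (1 - r) ^ 2))%R.
Proof.
intros Hx; assert (H0 := Cmod_ge_0 x).
assert (H1 : 1 - x <> 0) by (apply one_minus_neq_0; lra).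
assert (Hd : (1 - r <= Cmod (1 - x))%R).
{ assert (H := Cmod_triangle (1 - x) x).
  replace (1 - x + x) with (1 : C) in H by ring. rewrite Cmod_1 in H; lra. }
rewrite Cmod_div by (apply Cpow_nz; exact H1); rewrite !Cmod_mult, !Cmod_pow.
assert (Hn : (Cmod (RtoC (INR (S n)) - RtoC (INR n) * x) <= INR (S n) * 2)%R).
{ apply Rle_trans with (1 := Cmod_triangle _ _).
  rewrite Cmod_opp, Cmod_mult, !Cmod_R, !Rabs_pos_eq by apply pos_INR.
  rewrite S_INR; assert (Hp := pos_INR n); nra. }
assert (Hpow : (Cmod x ^ n <= r ^ n)%R) by (apply pow_incr; lra).
assert (Hpow0 : (0 <= Cmod x ^ n)%R) by (apply pow_le; lra).
unfold Rdiv at 1; replace (Cmod x * (INR (S n) * r ^ n) * (2 / (1 - r) ^ 2))%R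
  with (Cmod x * (r ^ n * (INR (S n) * 2)) * / (1 - r) ^ 2)%R
  by (field; lra).
apply Rmult_le_compat.
- apply Rmult_le_pos, Rmult_le_pos; auto; apply Cmod_ge_0.
- left; apply Rinv_0_lt_compat, pow_lt; lra.
- apply Rmult_le_compat_l; [exact H0|].
  apply Rmult_le_compat; auto; apply Cmod_ge_0.
- apply Rinv_le_contravar; [apply pow_lt; lra|apply pow_incr; lra].
Qed.

(** Both sides are the double sum of [k (a p^j)^k]; it is truncated to a square
    and summed in either order, so that only finite sums are interchanged. *)
Lemma lambert_sum (a p : C) : (Cmod a < 1)%R -> (Cmod p < 1)%R ->
  cvg (fun n => csum (fun k => RtoC (INR (S k)) * (a ^ S k / (1 - p ^ S k))) n -
                csum (fun j => koebe (a * p ^ j)) n) 0.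
Proof.
intros Ha Hp.
assert (Ha0 := Cmod_ge_0 a). assert (Hp0 := Cmod_ge_0 p).
assert (Hpn := one_minus_mult_pow_neq_0 p p Hp Hp).
destruct (one_minus_inv_bounded p p Hp Hpn) as [Gp HGp].
assert (HGp0 : (0 <= Gp)%R) by (apply Rle_trans with (2 := HGp O), Cmod_ge_0).
set (D := fun n => csum (fun k => csum (fun j =>
   RtoC (INR (S k)) * (a * p ^ j) ^ S k) n) n).
assert (HD1 : forall n, D n = csum (fun k => RtoC (INR (S k)) *
   (a ^ S k / (1 - p ^ S k))) n - csum (fun k => RtoC (INR (S k)) *
   (a ^ S k / (1 - p ^ S k)) * (p ^ S k) ^ n) n).
{ intros n; unfold D; rewrite <- csum_minus; apply csum_ext; intros k _.
  rewrite (csum_ext _ (fun j => RtoC (INR (S k)) * a ^ S k * (p ^ S k) ^ j)).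
  2:{ intros j _; rewrite Cpow_mult_l, <- !Cpow_mult_r, (Nat.mul_comm j); ring. }
  rewrite csum_scal; assert (E := csum_geom (p ^ S k) n).
  assert (Hk : 1 - p ^ S k <> 0) by apply Hpn.
  generalize dependent (p ^ S k); intros P E Hk.
  generalize (a ^ S k) (RtoC (INR (S k))); intros A R.
  change (csum (Cpow P) n) with (csum (fun j => P ^ j) n).
  transitivity (R * A / (1 - P) * ((1 - P) * csum (fun j => P ^ j) n));
    [field; exact Hk|].
  rewrite E; field; exact Hk. }
assert (Hx : forall j, (Cmod (a * p ^ j) <= Cmod a * Cmod p ^ j)%R)
  by (intros; rewrite Cmod_mult, Cmod_pow; lra).
assert (Hpj : forall j, (0 <= Cmod p ^ j <= 1)%R).
{ intros j; split; [apply pow_le; lra|].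
  rewrite <- (pow1 j); apply pow_incr; lra. }
assert (Hxa : forall j, (Cmod (a * p ^ j) <= Cmod a < 1)%R).
{ intros j; specialize (Hx j); specialize (Hpj j); split; [nra|lra]. }
assert (HD2 : forall n, D n = csum (fun j => koebe (a * p ^ j)) n -
   csum (fun j => a * p ^ j * ((a * p ^ j) ^ n * (RtoC (INR (S n)) -
     RtoC (INR n) * (a * p ^ j))) / (1 - a * p ^ j) ^ 2) n).
{ intros n; unfold D; rewrite csum_swap, <- csum_minus.
  apply csum_ext; intros j _; apply csum_arith_geom.
  apply one_minus_neq_0; specialize (Hxa j); lra. }
apply (cvg_ext (fun n => csum (fun k => RtoC (INR (S k)) *
   (a ^ S k / (1 - p ^ S k)) * (p ^ S k) ^ n) n -
   csum (fun j => a * p ^ j * ((a * p ^ j) ^ n * (RtoC (INR (S n)) -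
     RtoC (INR n) * (a * p ^ j))) / (1 - a * p ^ j) ^ 2) n)).
{ intros n; specialize (HD1 n); rewrite HD2 in HD1.
  match type of HD1 with ?u - ?v = ?x - ?y =>
    replace x with (x - y + y) by ring; rewrite <- HD1; ring end. }
apply cvg_eq with (0 - 0); [|ring]; apply cvg_minus.
- apply (tannery (fun n k => RtoC (INR (S k)) *
   (a ^ S k / (1 - p ^ S k)) * (p ^ S k) ^ n) (fun n => n)
   (fun k => Gp * (INR (S k) * Cmod a ^ k))%R).
  + apply summable_scal, summable_arith_geom; [exact HGp0|lra].
  + intros n k _; unfold Cdiv; rewrite !Cmod_mult.
    rewrite Cmod_R, Rabs_pos_eq by apply pos_INR.
    replace (Gp * (INR (S k) * Cmod a ^ k))%R
      with (INR (S k) * (Cmod a ^ k * Gp) * 1)%R by ring.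
    apply Rmult_le_compat; try apply Cmod_ge_0.
    * apply Rmult_le_pos; [apply pos_INR|].
      apply Rmult_le_pos; apply Cmod_ge_0.
    * apply Rmult_le_compat_l; [apply pos_INR|].
      apply Rmult_le_compat; try apply Cmod_ge_0; [|apply HGp].
      apply Cmod_pow_S_le; lra.
    * rewrite <- Cpow_mult_r, Cmod_pow; apply Hpj.
  + intros k.
    match goal with |- cvg (fun n => ?c * _) _ =>
      apply cvg_eq with (c * 0); [|ring] end.
    apply cvg_scal, cvg_pow.
    apply (Cmod_mult_pow_lt p p k Hp Hp).
- destruct (arith_geom_bounded (Cmod a) (conj Ha0 Ha)) as [T HT].
  assert (HT0 : (0 <= T)%R).
  { apply Rle_trans with (2 := HT O); simpl; lra. }
  set (E := (2 / (1 - Cmod a) ^ 2)%R).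
  assert (HE : (0 <= E)%R).
  { apply Rmult_le_pos; [lra|]. left; apply Rinv_0_lt_compat, pow_lt; lra. }
  apply (tannery (fun n j => a * p ^ j * ((a * p ^ j) ^ n * (RtoC (INR (S n)) -
     RtoC (INR n) * (a * p ^ j))) / (1 - a * p ^ j) ^ 2) (fun n => n)
     (fun j => Cmod a * T * E * Cmod p ^ j)%R).
  + apply summable_scal, summable_geom; [|lra].
    apply Rmult_le_pos; [apply Rmult_le_pos; assumption|exact HE].
  + intros n j _; apply Rle_trans with (1 := arith_geom_error _ _ n (Hxa j)).
    fold E; replace (Cmod a * T * E * Cmod p ^ j)%R
      with (Cmod a * Cmod p ^ j * T * E)%R by ring.
    apply Rmult_le_compat_r; [exact HE|].
    apply Rmult_le_compat; [apply Cmod_ge_0| |apply Hx|apply HT].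
    apply Rmult_le_pos; [apply pos_INR|apply pow_le; lra].
  + intros j; apply cvg_of_bound with
      (fun n => Cmod (a * p ^ j) * (INR (S n) * Cmod a ^ n) * E)%R.
    * intros n; apply Rle_trans with (2 := arith_geom_error _ _ n (Hxa j)).
      apply Req_le; f_equal; ring.
    * apply is_lim_seq_eq with (Cmod (a * p ^ j) * 0 * E)%R; [|ring].
      repeat apply is_lim_seq_mult'; try apply is_lim_seq_const.
      apply arith_geom_null; lra.
Qed.

(** The addition formula: the product of the Kronecker sums of [a] and of
    [a' = p/a] is the difference of the values at [b] and at [a] of the
    elliptic function [sum_j koebe (x p^j)], which is, up to constants, the
    Weierstrass function of the torus [C^* / p^Z]. *)
Lemma kronecker_product (a a' b b' p K K' : C) :
  p <> 0 -> (Cmod p < 1)%R -> a * a' = p -> (Cmod a < 1)%R -> (Cmod a' < 1)%R ->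
  off_powers b b' p ->
  cvg (fun N => csum (kronecker_term a b p N) (2 * N + 1)) K ->
  cvg (fun N => csum (kronecker_term a' b p N) (2 * N + 1)) K' ->
  cvg (fun N => csum (fun n => koebe (b * p ^ n)) (N + 1) +
                csum (fun n => koebe (b' * p ^ n)) N -
                csum (fun n => koebe (a * p ^ n)) (2 * N + 1) -
                csum (fun n => koebe (a' * p ^ n)) (2 * N + 1)) (b * K * K').
Proof.
intros Hp Hp1 Ha Ha1 Ha1' Hb HK HK'.
assert (Hpn := one_minus_mult_pow_neq_0 p p Hp1 Hp1).
assert (Ha0 : a <> 0) by (intros e; apply Hp; rewrite <- Ha, e; ring).
assert (Ha0' : a' <> 0) by (intros e; apply Hp; rewrite <- Ha, e; ring).
assert (Hb0 := off_powers_neq_0 _ _ _ Hp Hb).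
assert (Hodd : forall m : nat, exists N,
  forall n, (N <= n)%nat -> (m <= 2 * n + 1)%nat)
  by (intros m; exists m; intros; lia).
assert (HL := cvg_subseq _ _ (fun N => 2 * N + 1)%nat Hodd (lambert_sum a p Ha1 Hp1)).
assert (HL' := cvg_subseq _ _ (fun N => 2 * N + 1)%nat Hodd (lambert_sum a' p Ha1' Hp1)).
assert (HO := off_diagonal_sum a a' b b' p Hp Hp1 Ha1 Ha1' Hb).
cbv zeta in HO.
assert (H := cvg_minus _ _ _ _ (cvg_mult _ _ _ _ (cvg_scal b _ _ HK) HK') HO).
assert (H' := cvg_plus _ _ _ _ H (cvg_plus _ _ _ _ HL HL')).
apply cvg_eq with (b * K * K' - 0 + (0 + 0)); [|ring].
revert H'; apply cvg_ext; intros N; clear - Hp Hp1 Ha Hb Hpn Ha0 Ha0' Hb0.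
set (c := b / p ^ N).
assert (HpN := Cpow_nz p N Hp).
assert (Hw := window_neq_0 b b' p N Hp Hb).
assert (T := truncated_product a a' p c (2 * N + 1) Ha Hpn ltac:(intros; apply Hw)).
cbv zeta in T.
assert (EK : forall x, csum (kronecker_term x b p N) (2 * N + 1) =
  / x ^ N * csum (fun i => x ^ i * / (1 - c * p ^ i)) (2 * N + 1)).
{ intros x; rewrite <- csum_scal; apply csum_ext; intros i _.
  unfold kronecker_term; fold c; unfold Cdiv; ring. }
rewrite !EK.
match type of T with c * ?A * ?A' = ?R =>
  replace (b * (/ a ^ N * A) * (/ a' ^ N * A')) with (c * A * A') end.
2:{ unfold c; rewrite <- Ha, Cpow_mult_l; field; split; apply Cpow_nz; auto. }
rewrite T; clear T EK.
rewrite (csum_central (fun i => koebe (c * p ^ i))).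
rewrite (csum_ext (fun n => koebe (c * p ^ (N + n))) (fun n => koebe (b * p ^ n)))
  by (intros; unfold c; rewrite window_right by exact Hp; reflexivity).
rewrite (csum_ext (fun n => koebe (c * p ^ (N - 1 - n))) (fun n => koebe (b' * p ^ n))).
2:{ intros n Hn; unfold c; rewrite (window_left b b') by (auto; apply Hb).
    apply koebe_inv; [apply Cmult_neq_0; [|apply Cpow_nz]|apply Hb]; tauto. }
assert (ES : csum (fun k => lambert_weight a a' p (S k) *
    (csum (fun i => / (1 - c * p ^ i) - / (1 - c * p ^ (i + S k)))
       (2 * N + 1 - S k) + RtoC (INR (S k)))) (2 * N + 1) =
  csum (fun k => lambert_weight a a' p (S k) *
    csum (fun i => / (1 - c * p ^ i) - / (1 - c * p ^ (i + S k)))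
       (2 * N + 1 - S k)) (2 * N + 1) +
  (csum (fun k => RtoC (INR (S k)) * (a ^ S k / (1 - p ^ S k))) (2 * N + 1) +
   csum (fun k => RtoC (INR (S k)) * (a' ^ S k / (1 - p ^ S k))) (2 * N + 1))).
{ rewrite <- !csum_plus; apply csum_ext; intros k _.
  unfold lambert_weight, Cdiv; ring. }
rewrite ES; ring.
Qed.
(** * Theta quotients and the nome *)

(** The factors of [(a; q)_oo] sorted by the residue of their index modulo 3. *)
Lemma qpoch_inf_trisection (a q : C) : (Cmod q < 1)%R ->
  qpoch_inf a q =
  qpoch_inf a (q ^ 3) * qpoch_inf (a * q) (q ^ 3) * qpoch_inf (a * q ^ 2) (q ^ 3).
Proof.
intros Hq.
assert (Hq3 : (Cmod (q ^ 3) < 1)%R).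
{ replace (q ^ 3) with (q * q ^ 2) by ring; apply Cmod_mult_pow_lt; exact Hq. }
apply cvg_unique with (fun n => qpoch_fin a q (3 * n)).
- apply (cvg_subseq (qpoch_fin a q) _ (fun n => 3 * n)%nat);
    [intros K; exists K; intros; lia|apply cvg_qpoch, Hq].
- apply (cvg_ext (fun n => qpoch_fin a (q ^ 3) n * qpoch_fin (a * q) (q ^ 3) n *
    qpoch_fin (a * q ^ 2) (q ^ 3) n)).
  + induction n as [|n IH]; [simpl; ring|].
    replace (3 * S n)%nat with (S (S (S (3 * n)))) by lia; cbn [qpoch_fin].
    rewrite <- IH, <- !Cpow_mult_r, !Cpow_S; ring.
  + repeat apply cvg_mult; apply cvg_qpoch, Hq3.
Qed.

Lemma Cpow_lt_1 (q : C) n : (Cmod q < 1)%R -> (Cmod (q ^ S n) < 1)%R.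
Proof.
intros H; rewrite Cpow_S; apply Cmod_mult_pow_lt; exact H.
Qed.

Lemma psi_neq_0 (q : C) : (Cmod q < 1)%R -> psi q <> 0.
Proof.
intros Hq; assert (Hq2 := Cpow_lt_1 q 1 Hq).
assert (H1 : qpoch_inf (q ^ 2) (q ^ 2) <> 0)
  by (apply qpoch_inf_neq_0, one_minus_mult_pow_neq_0; auto).
assert (H2 : qpoch_inf q (q ^ 2) <> 0)
  by (apply qpoch_inf_neq_0, one_minus_mult_pow_neq_0; auto).
unfold psi, Cdiv; apply Cmult_neq_0; [exact H1|].
intros E; apply C1_nz; rewrite <- (Cinv_r _ H2), E; ring.
Qed.

Lemma psi_cubed_quotient (q : C) : (Cmod q < 1)%R ->
  psi (q ^ 3) ^ 3 / psi q =
  qpoch_inf (q ^ 6) (q ^ 6) ^ 2 * qpoch_inf (q ^ 5) (q ^ 6) * qpoch_inf q (q ^ 6) /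
  (qpoch_inf (q ^ 3) (q ^ 6) * qpoch_inf (q ^ 3) (q ^ 6) *
   qpoch_inf (q ^ 2) (q ^ 6) * qpoch_inf (q ^ 4) (q ^ 6)).
Proof.
intros Hq; assert (Hq2 := Cpow_lt_1 q 1 Hq); assert (Hq6 := Cpow_lt_1 q 5 Hq).
unfold psi.
rewrite (qpoch_inf_trisection (q ^ 2) (q ^ 2)), (qpoch_inf_trisection q (q ^ 2))
  by exact Hq2.
rewrite <- !Cpow_mult_r; simpl (2 * 3)%nat; simpl (2 * 2)%nat; simpl (3 * 2)%nat.
replace (q ^ 2 * q ^ 2) with (q ^ 4) by ring.
replace (q ^ 2 * q ^ 4) with (q ^ 6) by ring.
replace (q * q ^ 2) with (q ^ 3) by ring.
replace (q * q ^ 4) with (q ^ 5) by ring.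
assert (H : forall n, qpoch_inf (q ^ S n) (q ^ 6) <> 0).
{ intros n; apply qpoch_inf_neq_0, one_minus_mult_pow_neq_0; auto.
  apply Cpow_lt_1, Hq. }
assert (H1 := H 0%nat); rewrite Cpow_1_r in H1.
assert (H2 := H 1%nat); assert (H3 := H 2%nat); assert (H4 := H 3%nat).
assert (H5 := H 4%nat); assert (H6 := H 5%nat).
generalize dependent (qpoch_inf (q ^ 6) (q ^ 6)).
generalize dependent (qpoch_inf (q ^ 5) (q ^ 6)).
generalize dependent (qpoch_inf (q ^ 4) (q ^ 6)).
generalize dependent (qpoch_inf (q ^ 3) (q ^ 6)).
generalize dependent (qpoch_inf (q ^ 2) (q ^ 6)).
generalize dependent (qpoch_inf q (q ^ 6)).
intros; field; repeat split; auto.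
Qed.

Lemma Cexp_plus (z w : C) : Cexp (z + w) = Cexp z * Cexp w.
Proof.
destruct z as [x y], w as [x' y']; unfold Cexp; simpl.
rewrite exp_plus, cos_plus, sin_plus; unfold RtoC, Cmult; simpl.
f_equal; ring.
Qed.

Lemma Cmod_Cexp (z : C) : Cmod (Cexp z) = exp (Re z).
Proof.
unfold Cexp; rewrite Cmod_mult, Cmod_R, Rabs_pos_eq by (left; apply exp_pos).
replace (Cmod (cos (Im z), sin (Im z))) with 1%R; [ring|].
unfold Cmod; simpl fst; simpl snd.
assert (H := sin2_cos2 (Im z)); unfold Rsqr in H.
replace (cos (Im z) ^ 2 + sin (Im z) ^ 2)%R with 1%R by (simpl; lra).
symmetry; apply sqrt_1.
Qed.

Lemma nome_pow_plus (tau : C) (a b : R) :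
  nome_pow tau (a + b) = nome_pow tau a * nome_pow tau b.
Proof.
unfold nome_pow; rewrite <- Cexp_plus, RtoC_plus; f_equal; ring.
Qed.

Lemma Cexp_neq_0 (z : C) : Cexp z <> 0.
Proof. apply Cmod_gt_0; rewrite Cmod_Cexp; apply exp_pos. Qed.

Lemma Cmod_nome_lt_1 (tau : C) : (0 < Im tau)%R -> (Cmod (nome tau) < 1)%R.
Proof.
intros H; unfold nome, nome_pow; rewrite Cmod_Cexp.
apply Rlt_le_trans with (exp 0); [apply exp_increasing|rewrite exp_0; lra].
replace (Re (RtoC PI * Ci * tau * 1)) with (- (PI * Im tau))%R
  by (destruct tau; simpl; ring).
assert (Hpi := Rmult_lt_0_compat _ _ PI_RGT_0 H); lra.
Qed.

Lemma Gosper_Pi_quotient (tau : C) : (0 < Im tau)%R ->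
  let q := nome tau in
  Gosper_Pi tau 3 ^ 3 / Gosper_Pi tau 1 = q ^ 2 * (psi (q ^ 3) ^ 3 / psi q) ^ 2.
Proof.
intros Ht q; unfold Gosper_Pi; fold q; rewrite Cpow_1_r.
assert (Hpsi : psi q <> 0) by (apply psi_neq_0, Cmod_nome_lt_1, Ht).
assert (Hn : nome_pow tau (INR 1 / 4) <> 0) by apply Cexp_neq_0.
(* [3 * (3/4) = 1/4 + 2] *)
assert (E : nome_pow tau (INR 3 / 4) ^ 3 = nome_pow tau (INR 1 / 4) * q ^ 2).
{ unfold q, nome; simpl (_ ^ 3); simpl (_ ^ 2); rewrite !Cmult_1_r.
  rewrite <- !nome_pow_plus; apply (f_equal (nome_pow tau)); simpl; lra. }
rewrite Cpow_mult_l, E; field; auto.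
Qed.

(** * The series *)

Lemma koebe_series_cvg (a p : C) : (Cmod a < 1)%R -> (Cmod p < 1)%R ->
  exists l, cvg (csum (fun n => koebe (a * p ^ n))) l.
Proof.
intros Ha Hp.
destruct (one_minus_inv_bounded a p Hp (one_minus_mult_pow_neq_0 a p Ha Hp))
  as [G HG].
assert (HG0 : (0 <= G)%R) by (apply Rle_trans with (2 := HG O), Cmod_ge_0).
assert (Hp0 := Cmod_ge_0 p). assert (Ha0 := Cmod_ge_0 a).
apply summable_cvg, summable_le with (fun n => Cmod a * (G * G) * Cmod p ^ n)%R.
- intros n; split; [apply Cmod_ge_0|]; unfold koebe.
  assert (H1 := one_minus_mult_pow_neq_0 a p Ha Hp n).
  replace (a * p ^ n / (1 - a * p ^ n) ^ 2)
    with (a * p ^ n * (/ (1 - a * p ^ n) * / (1 - a * p ^ n))) by (field; exact H1).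
  rewrite !Cmod_mult, Cmod_pow.
  replace (Cmod a * (G * G) * Cmod p ^ n)%R
    with (Cmod a * Cmod p ^ n * (G * G))%R by ring.
  apply Rmult_le_compat_l.
  + apply Rmult_le_pos; [exact Ha0|apply pow_le; exact Hp0].
  + apply Rmult_le_compat; try apply Cmod_ge_0; apply HG.
- apply summable_scal, summable_geom; [|lra].
  apply Rmult_le_pos; [|apply Rmult_le_pos]; assumption.
Qed.

Lemma csum_koebe_trisection (x : C) N :
  csum (fun n => koebe (x * x ^ n)) (3 * N + 1) =
  csum (fun n => koebe (x * (x ^ 3) ^ n)) (N + 1) +
  csum (fun n => koebe (x ^ 2 * (x ^ 3) ^ n)) N +
  csum (fun n => koebe (x ^ 3 * (x ^ 3) ^ n)) N.
Proof.
induction N as [|N IH]; [simpl; ring|].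
replace (3 * S N + 1)%nat with (S (S (S (3 * N + 1)))) by lia.
replace (S N + 1)%nat with (S (N + 1)) by lia; cbn [csum]; rewrite IH.
replace (x * x ^ S (3 * N + 1)) with (x ^ 3 * (x ^ 3) ^ N).
2:{ rewrite <- Cpow_mult_r, Nat.add_1_r, !Cpow_S; ring. }
replace (x * x ^ (3 * N + 1)) with (x ^ 2 * (x ^ 3) ^ N).
2:{ rewrite <- Cpow_mult_r, Nat.add_1_r, !Cpow_S; ring. }
replace (x * x ^ S (S (3 * N + 1))) with (x * (x ^ 3) ^ (N + 1)).
2:{ change (S (S (3 * N + 1))) with (2 + (3 * N + 1))%nat.
    rewrite !Cpow_add_r, !Cpow_1_r, <- Cpow_mult_r; ring. }
ring.
Qed.

Theorem theorem2 : forall tau : C, (0 < Im tau)%R ->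
  let q := nome tau in
  @is_series C_AbsRing C_NormedModule
    (fun k : nat =>
       let n := S k in
       q ^ (2 * n) / (1 - q ^ (2 * n)) ^ 2
       - q ^ (6 * n) / (1 - q ^ (6 * n)) ^ 2
       - 2 * q ^ (6 * n - 3) / (1 - q ^ (6 * n - 3)) ^ 2)
    (Gosper_Pi tau 3 ^ 3 / Gosper_Pi tau 1).
Proof.
intros tau Ht q.
assert (Hq : (Cmod q < 1)%R) by (apply Cmod_nome_lt_1, Ht).
assert (Hq0 : q <> 0) by apply Cexp_neq_0.
assert (Hlt := fun n => Cpow_lt_1 q n Hq).
set (p := q ^ 6).
assert (Hp : p <> 0) by (apply Cpow_nz, Hq0).
assert (Hp1 : (Cmod p < 1)%R) by apply Hlt.
destruct (koebe_series_cvg (q ^ 2) (q ^ 2) (Hlt 1%nat) (Hlt 1%nat)) as [S2 H2].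
destruct (koebe_series_cvg p p Hp1 Hp1) as [S6 H6].
destruct (koebe_series_cvg (q ^ 3) p (Hlt 2%nat) Hp1) as [S3 H3].
(* [a = a' = q^3], [b = q^2] and [b' = p/b = q^4] in the product formula *)
assert (Hoff : off_powers (q ^ 2) (q ^ 4) p).
{ split; [unfold p; ring|]; split; apply one_minus_mult_pow_neq_0; auto. }
assert (Haa : q ^ 3 * q ^ 3 = p) by (unfold p; ring).
assert (HK := kronecker_sum (q ^ 3) (q ^ 3) (q ^ 2) (q ^ 4) p Hp Hp1 Haa
  (Hlt 2%nat) (Hlt 2%nat) Hoff).
assert (HP := kronecker_product _ _ _ _ _ _ _ Hp Hp1 Haa
  (Hlt 2%nat) (Hlt 2%nat) Hoff HK HK).
replace (q ^ 3 * q ^ 2) with (q ^ 5) in HP by ring.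
replace (q ^ 3 / q ^ 2) with q in HP by (field; exact Hq0).
unfold p in HP; rewrite <- psi_cubed_quotient in HP by exact Hq; fold p in HP.
assert (Hval : S2 - S6 - S3 - S3 = q ^ 2 * (psi (q ^ 3) ^ 3 / psi q) ^ 2).
{ refine (eq_trans (cvg_unique _ _ _ _ HP) _); [|ring].
  apply (cvg_ext (fun N => csum (fun n => koebe (q ^ 2 * (q ^ 2) ^ n)) (3 * N + 1) -
    csum (fun n => koebe (p * p ^ n)) N -
    csum (fun n => koebe (q ^ 3 * p ^ n)) (2 * N + 1) -
    csum (fun n => koebe (q ^ 3 * p ^ n)) (2 * N + 1))).
  - intros N; rewrite csum_koebe_trisection, <- !Cpow_mult_r.
    simpl (2 * 3)%nat; simpl (2 * 2)%nat; fold p; ring.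
  - assert (Hodd : cvg (fun N => csum (fun n => koebe (q ^ 3 * p ^ n)) (2 * N + 1)) S3).
    { apply (cvg_subseq _ _ (fun N => 2 * N + 1)%nat);
        [intros K; exists K; intros; lia|exact H3]. }
    repeat apply cvg_minus; auto.
    apply (cvg_subseq _ _ (fun N => 3 * N + 1)%nat);
      [intros K; exists K; intros; lia|exact H2]. }
rewrite Gosper_Pi_quotient by exact Ht; fold q; rewrite <- Hval.
apply is_series_csum.
apply (cvg_ext (fun n => csum (fun n => koebe (q ^ 2 * (q ^ 2) ^ n)) n -
  csum (fun n => koebe (p * p ^ n)) n - csum (fun n => koebe (q ^ 3 * p ^ n)) n -
  csum (fun n => koebe (q ^ 3 * p ^ n)) n)).
- intros n; rewrite <- !csum_minus; apply csum_ext; intros k _.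
  rewrite <- !Cpow_S; unfold p; rewrite <- !Cpow_mult_r, <- Cpow_add_r.
  replace (6 * S k - 3)%nat with (3 + 6 * k)%nat by lia.
  unfold koebe, Cdiv; ring.
- repeat apply cvg_minus; assumption.
Qed.
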